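(* In the setting of the context, let $\varphi$ be $C^2$-strictly decomposable at $\bar x$ for $\bar\lambda\in\mathcal{Q}$ with decomposition pair $(\sigma_{\mathcal{Q}},F)$, where $\bar v=\mathcal{D}F(\bar x)^\top\bar\lambda$. (a) Suppose there is a sequence $(x^k,v^k)\in\mathrm{gph}(\partial\varphi)$ with $(x^k,v^k)\to(\bar x,\bar v)$ such that $\varphi$ is twice epi-differentiable at $x^k$ for $v^k$ for all $k\in\mathbb{N}$. Assume further that there exist a constant $M>0$ and a sequence $\{\lambda^k\}_k$ with $v^k=\mathcal{D}F(x^k)^\top\lambda^k$ and $\lambda^k\in\partial\sigma_{\mathcal{Q}}(F(x^k))$ such that: (i) there are linear subspaces $L_k\subseteq\mathrm{lin}(T_{\mathcal{Q}}(\lambda^k))$ with $L_k\to\mathrm{lin}(T_{\mathcal{Q}}(\bar\lambda))$; (ii) for all $p\in L_k$ with $\|p\|=1$ we have $\mathrm{dist}(0,T^2_{\mathcal{Q}}(\lambda^k,p))<M$. Then, for all $w\in\mathbb{R}^n$, $$\Big(\operatorname*{e-liminf}_{k\to\infty}\,\mathrm{d}^2\varphi(x^k|\mathcal{D}F(x^k)^\top\lambda^k)\Big)(w)\ \ge\ \langle w,H(\bar x,\bar\lambda)w\rangle+\iota_{\mathrm{aff}(\mathcal{D}F(\bar x)^{-1}N_{\mathcal{Q}}(\bar\lambda))}(w).$$ (b) In particular, if $\mathcal{Q}$ has the outer second-order tangent path property at $\bar\lambda$, then, with $S:=\mathcal{D}F(\bar x)^{-1}N_{\mathcal{Q}}(\bar\lambda)$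 and $Q:=\Pi_{\mathrm{aff}(S)}H(\bar x,\bar\lambda)\Pi_{\mathrm{aff}(S)}$, for every sequence $(x^k,v^k)\in\mathrm{gph}(\partial\varphi)$ with $(x^k,v^k)\to(\bar x,\bar v)$ such that $\varphi$ is twice epi-differentiable at $x^k$ for $v^k$ and $\mathrm{d}^2\varphi(x^k|v^k)$ is generalized quadratic, it holds that $$\Big(\operatorname*{e-liminf}_{k\to\infty}\,\mathrm{d}^2\varphi(x^k|v^k)\Big)(w)\ \ge\ \langle w,Qw\rangle+\iota_{\mathrm{aff}(S)}(w)\quad\forall\,w\in\mathbb{R}^n.$$
   Context: Setting: $f:\mathbb{R}^n\to\mathbb{R}$ is twice continuously differentiable, $\varphi:\mathbb{R}^n\to(-\infty,\infty]$ is proper, lower semicontinuous (lsc) and prox-bounded, $\psi=f+\varphi$, $0\in\partial\psi(\bar x)$, $\bar v=-\nabla f(\bar x)$, $\tau>0$. Standing assumption: $\varphi$ is globally prox-regular at $\bar x$ for $\bar v$ with constant $\rho$ and $\tau\rho<1$; i.e. $\varphi$ is locally lsc at $\bar x$ and there is $\epsilon>0$ such that $\varphi(x')\ge\varphi(x)+\langle v,x'-x\rangle-\frac{\rho}{2}\|x'-x\|^2$ for all $x'\in\mathbb{R}^n$ whenever $\|x-\bar x\|<\epsilon$, $\|v-\bar v\|<\epsilon$, $v\in\partial\varphi(x)$, $\varphi(x)<\varphi(\bar x)+\epsilon$. Here $\partial$ is the limiting subdifferential. Decomposability: $\varphi$ is $C^2$-decomposable at $\bar x\in\mathrm{dom}(\varphi)$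 with pair $(\varphi_d,F)$ if there is an open neighborhood $U$ of $\bar x$ with $\varphi(x)=\varphi(\bar x)+\varphi_d(F(x))$ for $x\in U$, where $F:\mathbb{R}^n\to\mathbb{R}^m$ is twice continuously differentiable on $U$ with $F(\bar x)=0$; $\varphi_d=\sigma_{\mathcal{Q}}$ is the (proper) support function of a closed convex set $\mathcal{Q}\subseteq\mathbb{R}^m$; and Robinson's constraint qualification $0\in\mathrm{int}\{\mathcal{D}F(\bar x)\mathbb{R}^n-\mathrm{dom}(\varphi_d)\}$ holds. It is $C^2$-strictly decomposable at $\bar x$ for $\bar\lambda\in\mathcal{Q}$ if, in addition, $\mathcal{D}F(\bar x)\mathbb{R}^n-N_{\mathcal{Q}}(\bar\lambda)=\mathbb{R}^m$. Tangent objects: $T_{\mathcal{Q}}(\lambda)$, $N_{\mathcal{Q}}(\lambda)$ are the tangent and normal cones of the convex set $\mathcal{Q}$; $\mathrm{lin}(\cdot)$ is the lineality space; the outer second-order tangent set is $T^2_{\mathcal{Q}}(\lambda,p)=\{r:\exists\,t_k\downarrow0,\ \mathrm{dist}(\lambda+t_kp+\frac{t_k^2}{2}r,\mathcal{Q})=o(t_k^2)\}$; $\mathrm{dist}(0,\emptyset)=\infty$. Convergence of sets is Painlevé–Kuratowski convergence. Outer second-order tangent path property: $\mathcal{Q}$ has it at $\bar\lambda\in\mathcal{Q}$ if there are $M>0$ and a neighborhood $V$ of $\bar\lambda$ such that for all $\lambda\in\mathcal{Q}\cap V$: (i) one can select a linear subspace $L(\lambda)\subseteq\mathrm{lin}(T_{\mathcal{Q}}(\lambda))$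 such that $L(\lambda)\to\mathrm{lin}(T_{\mathcal{Q}}(\bar\lambda))$ as $\lambda\to\bar\lambda$; (ii) for all $p\in L(\lambda)$ with $\|p\|=1$, $\mathrm{dist}(0,T^2_{\mathcal{Q}}(\lambda,p))<M$. Second subderivative: $\mathrm{d}^2\theta(x|\alpha)(h)=\liminf_{t\downarrow0,\,\tilde h\to h}\Delta_t^2\theta(x|\alpha)(\tilde h)$ with $\Delta_t^2\theta(x|\alpha)(h)=\frac{\theta(x+th)-\theta(x)-t\langle\alpha,h\rangle}{\frac12t^2}$; $\theta$ is twice epi-differentiable at $x$ for $\alpha$ if the $\Delta_t^2\theta(x|\alpha)$ epi-converge as $t\downarrow0$. A function is generalized quadratic if it has the form $w\mapsto\langle w,Aw\rangle+\iota_L(w)$ with $A$ symmetric and $L$ a linear subspace. The lower epi-limit is $(\operatorname{e-liminf}_{k\to\infty}\theta_k)(w)=\liminf_{k\to\infty,\,\tilde w\to w}\theta_k(\tilde w)$. Notation: $H(x,\lambda)=\sum_{i=1}^m\lambda_i\nabla^2F_i(x)$; $\mathcal{D}F(\bar x)^{-1}K=\{w:\mathcal{D}F(\bar x)w\in K\}$; $\iota$ indicator function; $\mathrm{aff}$ affine hull; $\Pi_L$ orthogonal projection matrix onto the subspace $L$. *)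

(* Defs.v *)
From HB Require Import structures.
From mathcomp Require Import all_boot all_order all_algebra.
From mathcomp Require Import all_classical all_reals all_analysis.
Set Implicit Arguments.
Unset Strict Implicit.
Unset Printing Implicit Defensive.
Import Order.TTheory GRing.Theory Num.Theory.
Import numFieldNormedType.Exports.
Local Open Scope classical_set_scope.
Local Open Scope ring_scope.

(* Vectors of R^n are row vectors, as required by the library's Jacobian:
   'J F x is the transpose of the textbook matrix DF(x), so that DF(x) w is
   w *m 'J F x and DF(x)^T l is l *m ('J F x)^T.

   The library norm on 'rV[R]_n is the maximum norm.  It is used only through
   the topology it induces; all metric quantities below are Euclidean. *)

Definition dot (R : realType) (n : nat) (u v : 'rV[R]_n) : R :=
  (u *m v^T) 0 0.

Definition enorm (R : realType) (n : nat) (u : 'rV[R]_n) : R :=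
  Num.sqrt (dot u u).

(* <w, A w>, where A acts on column vectors *)
Definition quad (R : realType) (n : nat) (A : 'M[R]_n) (w : 'rV[R]_n) : R :=
  (w *m A *m w^T) 0 0.

Definition dist (R : realType) (n : nat) (x : 'rV[R]_n) (A : set 'rV[R]_n) :
    \bar R :=
  ereal_inf [set (enorm (x - y))%:E | y in A].

Definition indicator {R : realType} {T : Type} (A : set T) (x : T) : \bar R :=
  if `[< A x >] then 0%E else +oo%E.

Definition grad (R : realType) (n : nat) (f : 'rV[R]_n -> R) (x : 'rV[R]_n) :
    'rV[R]_n :=
  \row_i 'D_(delta_mx 0 i) f x.

Definition hess (R : realType) (n : nat) (f : 'rV[R]_n -> R) (x : 'rV[R]_n) :
    'M[R]_n :=
  'J (grad f) x.

Definition C2_on (R : realType) (n : nat) (U : set 'rV[R]_n)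
    (f : 'rV[R]_n -> R) : Prop :=
  forall x, U x ->
    [/\ differentiable f x, differentiable (grad f) x
      & {for x, continuous (hess f)}].

Definition C2_map_on (R : realType) (n m : nat) (U : set 'rV[R]_n)
    (F : 'rV[R]_n -> 'rV[R]_m) : Prop :=
  forall i : 'I_m, C2_on U (fun x => F x 0 i).

(* H(x, l) = \sum_i l_i Hess F_i(x) *)
Definition lagr_hess (R : realType) (n m : nat) (F : 'rV[R]_n -> 'rV[R]_m)
    (x : 'rV[R]_n) (l : 'rV[R]_m) : 'M[R]_n :=
  \sum_(i < m) l 0 i *: hess (fun y => F y 0 i) x.

(* Painleve-Kuratowski limits of a family of sets along a filter *)
Definition pk_liminf (I : Type) (T : topologicalType) (F : set_system I)
    (C : I -> set T) : set T :=
  [set x | forall V, nbhs x V -> \forall i \near F, C i `&` V !=set0].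

Definition pk_limsup (I : Type) (T : topologicalType) (F : set_system I)
    (C : I -> set T) : set T :=
  [set x | forall V, nbhs x V ->
     forall A, F A -> exists2 i, A i & C i `&` V !=set0].

Definition pk_cvg (I : Type) (T : topologicalType) (F : set_system I)
    (C : I -> set T) (D : set T) : Prop :=
  pk_liminf F C = D /\ pk_limsup F C = D.

Definition dom (R : realType) (T : Type) (g : T -> \bar R) : set T :=
  [set x | (g x < +oo)%E].

Definition proper_fun (R : realType) (T : Type) (g : T -> \bar R) : Prop :=
  (forall x, (-oo < g x)%E) /\ dom g !=set0.

(* some Moreau envelope of g is not identically -oo *)
Definition prox_bounded (R : realType) (n : nat) (g : 'rV[R]_n -> \bar R) :
    Prop :=
  exists2 c : R, 0 < c &
  exists x, (-oo < ereal_inf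
    (range (fun w => g w + ((2 * c)^-1 * enorm (w - x) ^+ 2)%:E)))%E.

Definition locally_lsc (R : realType) (n : nat) (g : 'rV[R]_n -> \bar R)
    (x : 'rV[R]_n) : Prop :=
  g x \is a fin_num /\
  exists2 e : R, 0 < e &
  forall a : R, (a%:E <= g x + e%:E)%E ->
    closed [set y | enorm (y - x) <= e /\ (g y <= a%:E)%E].

Definition regular_subdiff (R : realType) (n : nat) (g : 'rV[R]_n -> \bar R)
    (x : 'rV[R]_n) : set 'rV[R]_n :=
  [set v | g x \is a fin_num /\
     forall e : R, 0 < e -> \forall y \near x,
       (g x + (dot v (y - x) - e * enorm (y - x))%:E <= g y)%E].

(* the limiting subdifferential *)
Definition subdiff (R : realType) (n : nat) (g : 'rV[R]_n -> \bar R)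
    (x : 'rV[R]_n) : set 'rV[R]_n :=
  [set v | g x \is a fin_num /\
     exists xs vs : nat -> 'rV[R]_n,
       [/\ xs k @[k --> \oo] --> x, g (xs k) @[k --> \oo] --> g x,
           (forall k, regular_subdiff g (xs k) (vs k))
         & vs k @[k --> \oo] --> v]].

Definition globally_prox_regular (R : realType) (n : nat)
    (g : 'rV[R]_n -> \bar R) (xbar vbar : 'rV[R]_n) (rho : R) : Prop :=
  locally_lsc g xbar /\
  exists2 e : R, 0 < e &
  forall x v, enorm (x - xbar) < e -> enorm (v - vbar) < e ->
    subdiff g x v -> (g x < g xbar + e%:E)%E ->
    forall x', (g x + (dot v (x' - x) - rho / 2 * enorm (x' - x) ^+ 2)%:E
                <= g x')%E.

Definition epi_liminf (R : realType) (n : nat) (I : topologicalType)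
    (F : set_system I) (g : I -> 'rV[R]_n -> \bar R) (w : 'rV[R]_n) : \bar R :=
  limf_einf (fun p : I * 'rV[R]_n => g p.1 p.2) (filter_prod F (nbhs w)).

Definition epigraph (R : realType) (n : nat) (g : 'rV[R]_n -> \bar R) :
    set ('rV[R]_n * R) :=
  [set p | (g p.1 <= p.2%:E)%E].

Definition epi_cvg (R : realType) (n : nat) (I : Type) (F : set_system I)
    (g : I -> 'rV[R]_n -> \bar R) (h : 'rV[R]_n -> \bar R) : Prop :=
  pk_cvg F (fun i => epigraph (g i)) (epigraph h).

Definition diff_quot2 (R : realType) (n : nat) (g : 'rV[R]_n -> \bar R)
    (x a : 'rV[R]_n) (t : R) (h : 'rV[R]_n) : \bar R :=
  ((g (x + t *: h)%R - g x - (t * dot a h)%:E) * ((2^-1 * t ^+ 2)^-1)%:E)%E.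

Definition second_subderiv (R : realType) (n : nat) (g : 'rV[R]_n -> \bar R)
    (x a : 'rV[R]_n) : 'rV[R]_n -> \bar R :=
  epi_liminf (0 : R)^'+ (diff_quot2 g x a).

Definition twice_epi_differentiable (R : realType) (n : nat)
    (g : 'rV[R]_n -> \bar R) (x a : 'rV[R]_n) : Prop :=
  exists h : 'rV[R]_n -> \bar R, epi_cvg (0 : R)^'+ (diff_quot2 g x a) h.

Definition generalized_quadratic (R : realType) (n : nat)
    (g : 'rV[R]_n -> \bar R) : Prop :=
  exists (A : 'M[R]_n) (L : {vspace 'rV[R]_n}), A^T = A /\
  forall w, g w = ((quad A w)%:E + indicator [set` L] w)%E.

Definition support_fun (R : realType) (m : nat) (Q : set 'rV[R]_m)
    (y : 'rV[R]_m) : \bar R :=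
  ereal_sup [set (dot l y)%:E | l in Q].

Definition tangent_cone (R : realType) (m : nat) (Q : set 'rV[R]_m)
    (l : 'rV[R]_m) : set 'rV[R]_m :=
  [set w | exists (t : nat -> R) (ws : nat -> 'rV[R]_m),
     [/\ forall k, 0 < t k, t k @[k --> \oo] --> 0,
         ws k @[k --> \oo] --> w & forall k, Q (l + t k *: ws k)]].

Definition normal_cone (R : realType) (m : nat) (Q : set 'rV[R]_m)
    (l : 'rV[R]_m) : set 'rV[R]_m :=
  [set y | Q l /\ forall mu, Q mu -> dot y (mu - l) <= 0].

(* the lineality space of a convex cone K *)
Definition lineality (R : realType) (m : nat) (K : set 'rV[R]_m) :
    set 'rV[R]_m :=
  [set w | K w /\ K (- w)].

Definition tangent2 (R : realType) (m : nat) (Q : set 'rV[R]_m)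
    (l p : 'rV[R]_m) : set 'rV[R]_m :=
  [set r | exists t : nat -> R,
     [/\ forall k, 0 < t k, t k @[k --> \oo] --> 0
       & (dist (l + t k *: p + (t k ^+ 2 / 2) *: r) Q
            * ((t k ^+ 2)^-1)%:E)%E @[k --> \oo] --> 0%E]].

(* As usual for set limits relative to Q, the convergence of L l as l tends to
   lbar in Q includes l = lbar. *)
Definition tangent2_path_property (R : realType) (m : nat) (Q : set 'rV[R]_m)
    (lbar : 'rV[R]_m) : Prop :=
  Q lbar /\
  exists (M : R) (V : set 'rV[R]_m) (L : 'rV[R]_m -> {vspace 'rV[R]_m}),
  [/\ 0 < M, nbhs lbar V,
      forall l, Q l -> V l -> [set` L l] `<=` lineality (tangent_cone Q l),
      pk_cvg (within Q (nbhs lbar)) (fun l => [set` L l])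
        (lineality (tangent_cone Q lbar))
    & forall l, Q l -> V l -> forall p, p \in L l -> enorm p = 1 ->
        (dist 0 (tangent2 Q l p) < M%:E)%E].

Definition affine_hull (R : realType) (n : nat) (S : set 'rV[R]_n) :
    set 'rV[R]_n :=
  [set x | exists (k : nat) (a : 'I_k -> R) (s : 'I_k -> 'rV[R]_n),
     [/\ forall i, S (s i), \sum_i a i = 1 & x = \sum_i a i *: s i]].

(* the matrix of the orthogonal projection onto a linear subspace L
   (and a default value when L is not a linear subspace) *)
Definition orth_proj (R : realType) (n : nat) (L : set 'rV[R]_n) : 'M[R]_n :=
  xget 0 [set P | [/\ P^T = P, P *m P = P & range (fun w => w *m P) = L]].

Definition C2_decomposable (R : realType) (n m : nat)
    (phi : 'rV[R]_n -> \bar R) (xbar : 'rV[R]_n) (Q : set 'rV[R]_m)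
    (F : 'rV[R]_n -> 'rV[R]_m) : Prop :=
  [/\ phi xbar \is a fin_num,
      [/\ closed Q, convex_set Q & proper_fun (support_fun Q)],
      F xbar = 0,
      exists U : set 'rV[R]_n,
        [/\ open U, U xbar, C2_map_on U F
          & forall x, U x -> phi x = (phi xbar + support_fun Q (F x))%E]
    & [set a - b | a in range (fun h => h *m 'J F xbar)
                 & b in dom (support_fun Q)]° 0].

Definition C2_strictly_decomposable (R : realType) (n m : nat)
    (phi : 'rV[R]_n -> \bar R) (xbar : 'rV[R]_n) (Q : set 'rV[R]_m)
    (F : 'rV[R]_n -> 'rV[R]_m) (lbar : 'rV[R]_m) : Prop :=
  [/\ C2_decomposable phi xbar Q F, Q lbar
    & [set a - b | a in range (fun h => h *m 'J F xbar)
                 & b in normal_cone Q lbar] = setT].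

(* Main.v *)
Require Import Defs.
From HB Require Import structures.
From mathcomp Require Import all_boot all_order all_algebra.
From mathcomp Require Import all_classical all_reals all_analysis.
From mathcomp Require Import ring lra.
Import Order.TTheory GRing.Theory Num.Theory.
Import numFieldNormedType.Exports.
Local Open Scope classical_set_scope.
Local Open Scope ring_scope.
Set Implicit Arguments.
Unset Strict Implicit.
Unset Printing Implicit Defensive.

(** Near [xbar] the function [phi] is a constant plus the support function of
    [Q] composed with [F], and that support function is at least <mu, .> for
    every [mu] in [Q].  So at a pair (x, v) with v = DF(x)^T l, every [mu] in [Q]
    bounds the second-order difference quotient of [phi] from below by
      2 <mu - l, F x> / t^2 + 2 <mu - l, DF(x) h> / t + <mu, T(t, h)>,
    where [T(t, h)] is the second-order Taylor quotient of [F].  Taking mu = l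
    only yields the curvature term <w, H(x, l) w>.  To see in addition that the
    second subderivative is large off the affine hull of [S], [mu] is moved
    along a parabolic arc l + s p + (s^2/2) r in [Q], where s = a t, [p] is in the
    lineality space of the tangent cone and [r] is a second-order tangent.
    Because F x is normal to [Q] at [l], it is orthogonal to [p]; the limit is
      a^2 <r, F x> + 2 a <p, DF(x) w> + <w, H(x, l) w>.
    Second-order tangents only supply arcs along some sequence s_k -> 0; twice
    epi-differentiability makes that sufficient ([second_subderiv_ge]).

    Along the given sequence, F (x k) tends to F xbar = 0 while the second-order
    tangents stay bounded, so the first term disappears and the lower epi-limit
    is at least 2 a <p, DF(xbar) w> + <w, H(xbar, lbar) w> for every [p] in the
    lineality space at [lbar] and every a > 0 ([epi_liminf_ge]).  On the affine
    hull of [S] take p = 0.  A vector [w] outside is sent by DF(xbar) outside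
    the span of the normal cone, by the strict qualification
    ([affine_hull_preimage]); some [p] in the orthogonal complement of the
    normal cone, which is the lineality space, then gives a positive middle
    term, and [a] can be taken arbitrarily large.

    Two facts about multipliers are needed.  They converge to [lbar], since the
    strict qualification controls l - lbar by DF(x)^T l - DF(xbar)^T lbar
    ([multiplier_bound]).  And for part (b) they exist: every limiting
    subgradient of [phi] near [xbar] has the form DF(x)^T l with [l] a
    subgradient of the support function at F x.  This chain rule is obtained
    from Moreau envelopes of the support function, which are smooth and can be
    minimised together with a penalty, followed by a compactness argument
    ([fuzzy_chain_rule], [limiting_chain_rule]).  Finally the projection matrix
    fixes the affine hull of [S] pointwise ([orth_proj_id]), so that the
    quadratic forms in (a) and (b) coincide where they are finite. *)

(** * Euclidean product and norm *)

Section euclidean.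
Context {R : realType} {n : nat}.
Implicit Types (u v w : 'rV[R]_n) (a : R).

Lemma dotE u v : dot u v = \sum_i u 0 i * v 0 i.
Proof. by rewrite /dot mxE; apply: eq_bigr => i _; rewrite mxE. Qed.

Lemma dotC u v : dot u v = dot v u.
Proof. by rewrite !dotE; apply: eq_bigr => i _; rewrite mulrC. Qed.

Lemma dotDl u v w : dot (u + v) w = dot u w + dot v w.
Proof. by rewrite /dot mulmxDl mxE. Qed.

Lemma dotDr u v w : dot w (u + v) = dot w u + dot w v.
Proof. by rewrite dotC dotDl !(dotC w). Qed.

Lemma dotZl a u v : dot (a *: u) v = a * dot u v.
Proof. by rewrite /dot -scalemxAl mxE. Qed.

Lemma dotZr a u v : dot u (a *: v) = a * dot u v.
Proof. by rewrite dotC dotZl dotC. Qed.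

Lemma dotNl u v : dot (- u) v = - dot u v.
Proof. by rewrite -scaleN1r dotZl mulN1r. Qed.

Lemma dotNr u v : dot u (- v) = - dot u v.
Proof. by rewrite dotC dotNl dotC. Qed.

Lemma dotBl u v w : dot (u - v) w = dot u w - dot v w.
Proof. by rewrite dotDl dotNl. Qed.

Lemma dotBr u v w : dot w (u - v) = dot w u - dot w v.
Proof. by rewrite dotDr dotNr. Qed.

Lemma dot0l u : dot 0 u = 0.
Proof. by rewrite /dot mul0mx mxE. Qed.

Lemma dot0r u : dot u 0 = 0.
Proof. by rewrite dotC dot0l. Qed.

Definition dot_lin :=
  (dotDl, dotDr, dotNl, dotNr, dotZl, dotZr, @dot0l, @dot0r).

Lemma dot_ge0 u : 0 <= dot u u.
Proof. by rewrite dotE; apply: sumr_ge0 => i _; rewrite -expr2 sqr_ge0. Qed.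

Lemma dot_eq0 u : dot u u = 0 -> u = 0.
Proof.
rewrite dotE => /eqP; rewrite psumr_eq0 => [/allP u0|i _]; last first.
  by rewrite -expr2 sqr_ge0.
apply/rowP => i; rewrite mxE; apply/eqP.
by have := u0 i (mem_index_enum _); rewrite mulf_eq0 orbb.
Qed.

Lemma enorm_ge0 u : 0 <= enorm u.
Proof. exact: sqrtr_ge0. Qed.

Lemma enorm_sqr u : enorm u ^+ 2 = dot u u.
Proof. by rewrite sqr_sqrtr ?dot_ge0. Qed.

Lemma enorm0 : enorm (0 : 'rV[R]_n) = 0.
Proof. by rewrite /enorm dot0l sqrtr0. Qed.

Lemma enorm_eq0 u : enorm u = 0 -> u = 0.
Proof. by move=> u0; apply: dot_eq0; rewrite -enorm_sqr u0 expr0n. Qed.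

Lemma enormZ a u : enorm (a *: u) = `|a| * enorm u.
Proof.
by rewrite /enorm dotZl dotZr mulrA -expr2 sqrtrM ?sqr_ge0// sqrtr_sqr.
Qed.

Lemma enormN u : enorm (- u) = enorm u.
Proof. by rewrite -scaleN1r enormZ normrN1 mul1r. Qed.

Lemma cauchy_schwarz u v : dot u v <= enorm u * enorm v.
Proof.
have [v0|v0] := eqVneq (enorm v) 0;
  first by rewrite v0 (enorm_eq0 v0) dot0r mulr0.
have [u0|u0] := eqVneq (enorm u) 0;
  first by rewrite u0 (enorm_eq0 u0) dot0l mul0r.
have vg : 0 < enorm v by rewrite lt_def v0 enorm_ge0.
have := dot_ge0 (enorm v *: u - enorm u *: v).
rewrite !(dotBl, dotBr, dotZl, dotZr) -!enorm_sqr (dotC v u).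
have ug : 0 < enorm u by rewrite lt_def u0 enorm_ge0.
move=> h; rewrite leNgt; apply/negP => lt.
have := mulr_gt0 ug vg => uv.
nra.
Qed.

Lemma cauchy_schwarz_abs u v : `|dot u v| <= enorm u * enorm v.
Proof.
by rewrite ler_norml cauchy_schwarz lerNl -dotNl -(enormN u) cauchy_schwarz.
Qed.

Lemma enormD u v : enorm (u + v) <= enorm u + enorm v.
Proof.
rewrite -(@ler_pXn2r _ 2) ?nnegrE ?addr_ge0 ?enorm_ge0//.
rewrite enorm_sqr sqrrD !enorm_sqr !dotDl !dotDr (dotC v u).
have := cauchy_schwarz u v; lra.
Qed.

Lemma normr_coord m (A : 'M[R]_(m, n)) i j : `|A i j| <= `|A|.
Proof.
by rewrite [leRHS]/Num.norm /= mx_normrE; apply: (le_bigmax _ _ (i, j)).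
Qed.

Lemma normr_mx_le m (A : 'M[R]_(m, n)) a :
  0 <= a -> (forall i j, `|A i j| <= a) -> `|A| <= a.
Proof.
move=> a0 Aa; rewrite [leLHS]/Num.norm /= mx_normrE.
by apply/bigmax_leP; split => // -[i j] _; exact: Aa.
Qed.

Lemma normr_le_enorm u : `|u| <= enorm u.
Proof.
apply: normr_mx_le => [|i j]; first exact: enorm_ge0.
rewrite (ord1 i) -sqrtr_sqr ler_wsqrtr// dotE (bigD1 j)//= -expr2 lerDl.
by apply: sumr_ge0 => k _; rewrite -expr2 sqr_ge0.
Qed.

End euclidean.

(** * Limits of vectors and matrices *)

Section matrix_limits.
Context {R : realType} {I : Type} {G : set_system I} {FG : Filter G}.

Lemma cvg_mx m n (f : I -> 'M[R]_(m, n)) (l : 'M[R]_(m, n)) :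
  (forall i j, f t i j @[t --> G] --> l i j) -> f t @[t --> G] --> l.
Proof.
move=> fl; apply/cvg_mx_entourageP => A entA.
have H i j : \forall t \near G, (l i j, f t i j) \in A.
  have /cvg_entourageP/(_ A entA) := fl i j.
  by rewrite near_map; apply: filterS => t; rewrite inE.
rewrite near_map.
apply: (@filter_forall I _ (fun i t => forall j, (l i j, f t i j) \in A)) => i.
exact: (@filter_forall I _ (fun j t => (l i j, f t i j) \in A)).
Qed.

Lemma cvg_coord m n (f : I -> 'M[R]_(m, n)) (l : 'M[R]_(m, n)) i j :
  f t @[t --> G] --> l -> f t i j @[t --> G] --> l i j.
Proof.
apply: (@continuous_cvg _ _ _ G FG f (fun M : 'M[R]_(m, n) => M i j)).
exact: coord_continuous.
Qed.

Lemma cvg_mulmx m n p (f : I -> 'M[R]_(m, n)) (g : I -> 'M[R]_(n, p))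
    (a : 'M[R]_(m, n)) (b : 'M[R]_(n, p)) :
  f t @[t --> G] --> a -> g t @[t --> G] --> b ->
  (f t *m g t) @[t --> G] --> a *m b.
Proof.
move=> fa gb; apply: cvg_mx => i j; rewrite mxE.
under eq_fun do rewrite mxE.
apply: (@cvg_big R _ _ _ predT _ _ G) => [x|k _]; first exact: add_continuous.
by apply: cvgM; exact: cvg_coord.
Qed.

Lemma cvg_trmx m n (f : I -> 'M[R]_(m, n)) (a : 'M[R]_(m, n)) :
  f t @[t --> G] --> a -> (f t)^T @[t --> G] --> a^T.
Proof.
move=> fa; apply: cvg_mx => i j; rewrite mxE; under eq_fun do rewrite mxE.
exact: cvg_coord.
Qed.

Lemma cvg_dot n (f g : I -> 'rV[R]_n) (a b : 'rV[R]_n) :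
  f t @[t --> G] --> a -> g t @[t --> G] --> b ->
  dot (f t) (g t) @[t --> G] --> dot a b.
Proof. by move=> fa gb; apply/cvg_coord/cvg_mulmx/cvg_trmx. Qed.

Lemma cvg_quad n (f : I -> 'M[R]_n) (g : I -> 'rV[R]_n)
    (a : 'M[R]_n) (b : 'rV[R]_n) :
  f t @[t --> G] --> a -> g t @[t --> G] --> b ->
  quad (f t) (g t) @[t --> G] --> quad a b.
Proof.
by move=> fa gb; apply/cvg_coord/cvg_mulmx/cvg_trmx => //; exact: cvg_mulmx.
Qed.

Lemma cvg_enorm n (f : I -> 'rV[R]_n) (a : 'rV[R]_n) :
  f t @[t --> G] --> a -> enorm (f t) @[t --> G] --> enorm a.
Proof.
move=> fa; apply: (@continuous_cvg _ _ _ G FG _ Num.sqrt); last exact: cvg_dot.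
exact: sqrt_continuous.
Qed.

(** The bridge from Euclidean estimates to the topology of the maximum norm. *)
Lemma cvg_mx_enorm n (f : I -> 'rV[R]_n) (g : I -> R) (a : 'rV[R]_n) :
  (\forall t \near G, enorm (f t - a) <= g t) -> g t @[t --> G] --> 0 ->
  f t @[t --> G] --> a.
Proof.
move=> fg g0; apply/cvgrPdistC_lt => e e0.
have ge := @cvgr0_norm_lt _ _ _ G FG _ g0 _ e0.
apply: filterS2 fg ge => t fg; apply: le_lt_trans.
by rewrite (le_trans (normr_le_enorm _))// (le_trans fg)// ler_norm.
Qed.

End matrix_limits.

(** * Limits along ultrafilters *)

(** An ultrafilter turns compactness into convergence without passing to a
    subsequence, so that several sequences can be made to converge at once. *)
Lemma compact_cvg_ultra (I : Type) (T : topologicalType) (U : set_system I)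
    (A : set T) (f : I -> T) :
  UltraFilter U -> compact A -> U [set i | A (f i)] ->
  exists2 p, A p & f i @[i --> U] --> p.
Proof.
move=> UU cA UA.
have [p [Ap clp]] := cA _ (fmap_proper_filter f ultra_proper) UA.
exists p => // V Vp.
have [//|UnV] := in_ultra_setVsetC (f @^-1` V) UU.
have : (f i @[i --> U]) (~` V) by [].
by move=> /clp/(_ Vp) [x []].
Qed.

Lemma bounded_cvg_ultra (R : realType) (n : nat) (I : Type) (U : set_system I)
    (f : I -> 'rV[R]_n) (a : R) :
  UltraFilter U -> U [set i | `|f i| <= a] ->
  exists p : 'rV[R]_n, f i @[i --> U] --> p.
Proof.
move=> UU Ua.
have [|p _ fp] := @compact_cvg_ultra _ _ _
  [set x : 'rV[R]_n | `|x| <= a] _ UU _ Ua; last by exists p.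
apply: bounded_closed_compact.
  exists a; split; first exact: num_real.
  by move=> b ab x /= xa; rewrite (le_trans xa)// ltW.
apply: (@preimage_closed _ _ (fun x : 'rV[R]_n => `|x|) [set y | y <= a]).
  by move=> x _; exact: norm_continuous.
exact: closed_le.
Qed.

(** If the limit failed along [G], the filter generated by [G] and the
    complement of a bad neighbourhood would extend to an ultrafilter
    contradicting the hypothesis. Hence compactness plus uniqueness of the
    cluster point gives convergence. *)
Lemma cvg_ultra (I : Type) (T : topologicalType) (G : set_system I)
    (f : I -> T) (p : T) : Filter G ->
  (forall U, UltraFilter U -> G `<=` U -> f i @[i --> U] --> p) ->
  f i @[i --> G] --> p.
Proof.
move=> FG fU V Vp; apply: contrapT => nGV.
have PG : ProperFilter (within (~` (f @^-1` V)) G).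
  split; last exact: within_filter.
  rewrite /within /= => H; apply: nGV; apply: filterS H => i Hi.
  by apply: contrapT => nV; exact: Hi nV.
have [U [UU GU]] := ultraFilterLemma PG.
have GsubU : G `<=` U.
  by move=> A GA; apply: GU; apply: filterS GA => x Ax _.
have UV : U (f @^-1` V) by exact: (fU U UU GsubU V Vp).
have UnV : U (~` (f @^-1` V)).
  by apply: GU; exact: (@filterS _ G FG setT _ (fun _ _ => id) filterT).
by have [x []] := filter_ex (filterI UV UnV).
Qed.

(** * Projection onto a closed convex set *)

Section projection.
Context {R : realType} {m : nat}.
Implicit Types (Q : set 'rV[R]_m).

Lemma convex_segment Q x y (t : R) : convex_set Q -> Q x -> Q y ->
  0 <= t -> t <= 1 -> Q (x + t *: (y - x)).
Proof.
move=> cQ Qx Qy t0 t1.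
have := cQ y x (Itv01 t0 t1); rewrite !inE => /(_ Qy Qx).
rewrite /conv/= => H.
by rewrite scalerBr addrCA -[X in _ + (X - _)]scale1r -scalerBl.
Qed.

(** The variational characterisation of the nearest point of a convex set. *)
Definition is_proj Q (z q : 'rV[R]_m) : Prop :=
  Q q /\ forall y, Q y -> dot (z - q) (y - q) <= 0.

(** A nearest point [q] exists by compactness. If some [y] in [Q] made an
    acute angle with [z - q], a short step from [q] towards [y] would come
    closer to [z]. *)
Lemma ex_proj Q z : closed Q -> convex_set Q -> Q !=set0 ->
  exists q, is_proj Q z q.
Proof.
move=> clQ cQ [q0 Qq0].
have dcont : continuous (fun y : 'rV[R]_m => enorm (y - z)).
  move=> y; apply: (@cvg_enorm _ _ (nbhs y) _ _ (fun x => x - z)).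
  by apply: cvgB; [exact: cvg_id|exact: cvg_cst].
pose A := Q `&` [set y | enorm (y - z) <= enorm (q0 - z)].
have cA : compact A.
  apply: bounded_closed_compact.
    exists (enorm (q0 - z) + `|z|); split; first exact: num_real.
    move=> b ab x /= [_ xa]; rewrite -(subrK z x) (le_trans (ler_normD _ _))//.
    rewrite (le_trans _ (ltW ab))// lerD2r (le_trans _ xa)//.
    exact: normr_le_enorm.
  apply: closedI => //.
  apply: (@preimage_closed _ _ (fun y : 'rV[R]_m => enorm (y - z))
            [set y | y <= enorm (q0 - z)]); last exact: closed_le.
  by move=> x _; exact: dcont.
have [q] := @EVT_min_rV R m (fun y => enorm (y - z)) A
  (ex_intro _ q0 (conj Qq0 (lexx _))) cA (continuous_subspaceT dcont).
rewrite inE => -[Qq qq0] qmin.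
have {}qmin y : Q y -> enorm (q - z) <= enorm (y - z).
  move=> Qy; have [le|lt] := leP (enorm (y - z)) (enorm (q0 - z)).
    by apply: qmin; rewrite inE.
  by rewrite (le_trans qq0)// ltW.
exists q; split => // y Qy.
rewrite leNgt; apply/negP; set d := dot _ _ => d0.
set N := dot (y - q) (y - q); have N0 : 0 <= N by exact: dot_ge0.
(* d / N minimises the distance to z along the ray; adding d to the
   denominator keeps the step in the segment *)
pose t := d / (N + d).
have Nd0 : 0 < N + d by lra.
have t0 : 0 < t by exact: divr_gt0.
have t1 : t <= 1 by rewrite ler_pdivrMr//; lra.
have tN : t * N < d.
  rewrite /t mulrAC ltr_pdivrMr//; nra.
have := qmin _ (convex_segment cQ Qq Qy (ltW t0) t1).
rewrite -(@ler_pXn2r _ 2) ?nnegrE ?enorm_ge0// !enorm_sqr.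
have -> : q + t *: (y - q) - z = (q - z) + t *: (y - q) by rewrite addrAC.
have dE : dot (q - z) (y - q) = - d by rewrite -dotNl opprB.
have NE : dot (y - q) (y - q) = N by [].
move: dE NE; move: (q - z) (y - q) => e h dE NE.
rewrite !(dotDl, dotDr, dotZl, dotZr) (dotC h) dE NE => le.
have : t * (2 * d) <= t * (t * N) by lra.
by rewrite ler_pM2l// => ?; lra.
Qed.

Lemma is_proj_min Q z q y :
  is_proj Q z q -> Q y -> enorm (z - q) <= enorm (z - y).
Proof.
move=> [_ qP] Qy; have := qP y Qy.
have -> : z - y = (z - q) - (y - q) by rewrite opprB addrA subrK.
move: (z - q) (y - q) => e d ed.
rewrite -(@ler_pXn2r _ 2) ?nnegrE ?enorm_ge0// !enorm_sqr.
by rewrite !dot_lin (dotC d e); have := dot_ge0 d; lra.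
Qed.

End projection.

(** * Normal and tangent cones of a convex set *)

Section cones.
Context {R : realType} {m : nat}.
Implicit Types (Q K : set 'rV[R]_m) (l p y z : 'rV[R]_m).

Lemma normal_cone0 Q l : Q l -> normal_cone Q l 0.
Proof. by move=> Ql; split => // mu _; rewrite dot0l. Qed.

Lemma normal_coneD Q l y z :
  normal_cone Q l y -> normal_cone Q l z -> normal_cone Q l (y + z).
Proof.
move=> [Ql Ny] [_ Nz]; split => // mu Qmu.
by have := Ny _ Qmu; have := Nz _ Qmu; rewrite dotDl; lra.
Qed.

Lemma normal_coneZ Q l (a : R) y :
  0 <= a -> normal_cone Q l y -> normal_cone Q l (a *: y).
Proof.
move=> a0 [Ql Ny]; split => // mu Qmu.
by rewrite dotZl mulr_ge0_le0 ?Ny.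
Qed.

Lemma tangent_normal_le0 Q l y p :
  normal_cone Q l y -> tangent_cone Q l p -> dot y p <= 0.
Proof.
move=> [_ Ny] [t [ws [t0 _ wp Qw]]].
apply: (cvgr_to_le (@cvg_dot _ _ \oo _ _ (cst y) ws _ _ (cvg_cst _) wp)).
apply: nearW => k /=; have := Ny _ (Qw k).
by rewrite addrC addKr dotZr pmulr_rle0.
Qed.

Lemma lineality_perp_normal Q l y p :
  normal_cone Q l y -> lineality (tangent_cone Q l) p -> dot y p = 0.
Proof.
move=> Ny [Tp TNp]; apply: le_anti.
by rewrite (tangent_normal_le0 Ny Tp) -oppr_le0 -dotNr (tangent_normal_le0 Ny).
Qed.

(** The polar of the normal cone lies in the tangent cone. Project [l + t p]
    onto [Q] and let [n] be the defect [p - (q - l) / t]. It is normal at the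
    projection [q] and satisfies |n|^2 <= <n, p>; every limit of it is normal
    at [l], so <n, p> <= 0 and the limit vanishes. Thus (q - l) / t tends to
    [p]. *)
Lemma polar_normal_tangent Q l p : closed Q -> convex_set Q -> Q l ->
  (forall y, normal_cone Q l y -> dot y p <= 0) -> tangent_cone Q l p.
Proof.
move=> clQ cQ Ql Np.
have hg k : 0 < harmonic k :> R by rewrite invr_gt0.
have [q qP] : {q : nat -> 'rV[R]_m &
    forall k, is_proj Q (l + harmonic k *: p) (q k)}.
  by apply: (choice (fun k => ex_proj _ clQ cQ (ex_intro _ l Ql))).
pose nn k := p - (harmonic k)^-1 *: (q k - l).
have qE k : q k = l + harmonic k *: (p - nn k).
  by rewrite /nn subKr scalerA divff ?gt_eqF// scale1r addrC subrK.
have nP k y : Q y -> dot (nn k) (y - q k) <= 0.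
  move=> Qy; have [_ /(_ _ Qy)] := qP k.
  rewrite {1}qE scalerBr opprD opprB addrACA subrr add0r addrCA subrr addr0.
  by rewrite dotZl pmulr_rle0.
have np k : dot (nn k) (nn k) <= dot (nn k) p.
  have := nP k l Ql.
  by rewrite qE opprD addrA subrr add0r dotNr dotZr oppr_le0 pmulr_rge0//
    dotBr subr_ge0.
have nnp k : enorm (nn k) <= enorm p.
  have := np k; have := cauchy_schwarz (nn k) p; rewrite -enorm_sqr.
  have [->|n0] := eqVneq (enorm (nn k)) 0; first by rewrite enorm_ge0.
  have ng : 0 < enorm (nn k) by rewrite lt_def n0 enorm_ge0.
  by move=> ? ?; rewrite -(ler_pM2l ng) -expr2; lra.
have nn0 : nn k @[k --> \oo] --> (0 : 'rV[R]_m).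
  apply: cvg_ultra => U UU ooU.
  have [|n nn_n] := @bounded_cvg_ultra _ _ _ _ nn (enorm p) UU.
    by apply: filterE => k; exact: le_trans (normr_le_enorm _) (nnp k).
  have qU : q k @[k --> U] --> l.
    rewrite -[l]addr0 -(scale0r (p - n)).
    under eq_fun do rewrite qE.
    apply: cvgD; first exact: cvg_cst.
    apply: cvgZ; last by apply: cvgB => //; exact: cvg_cst.
    by move=> V /cvg_harmonic; exact: ooU.
  have Nn : normal_cone Q l n.
    split => // y Qy.
    apply: (cvgr_to_le (@cvg_dot _ _ U _ _ nn (fun k => y - q k) _ _ nn_n
      (cvgB (cvg_cst y) qU))).
    by apply: filterE => k; exact: nP.
  have nnle : dot n n <= dot n p.
    apply: (@ler_cvg_to _ U _ _ _ _ _ _ (cvg_dot nn_n nn_n)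
      (cvg_dot nn_n (cvg_cst p))).
    exact: filterE.
  suff <- : n = 0 by [].
  by apply/dot_eq0/le_anti; rewrite dot_ge0 andbT (le_trans nnle)// Np.
exists harmonic, (fun k => p - nn k); split => //.
- exact: cvg_harmonic.
- by rewrite -[X in _ --> X]subr0; apply: cvgB => //; exact: cvg_cst.
- by move=> k; rewrite -qE; have [] := qP k.
Qed.

Lemma perp_normal_lineality Q l p : closed Q -> convex_set Q -> Q l ->
  (forall y, normal_cone Q l y -> dot y p = 0) ->
  lineality (tangent_cone Q l) p.
Proof.
move=> clQ cQ Ql Np; split; apply: polar_normal_tangent => // y Ny.
  by rewrite Np.
by rewrite dotNr Np ?oppr0.
Qed.

(** A family in [K] of maximal rank spans [K]. Putting it in a matrix makes
    the span of an arbitrary set accessible to the matrix library. *)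
Lemma spanning_rows K : exists (k : nat) (B : 'M[R]_(k, m)),
  (forall i, K (row i B)) /\ (forall y, K y -> (y <= B)%MS).
Proof.
pose P r := `[< exists (k : nat) (B : 'M[R]_(k, m)),
  (forall i, K (row i B)) /\ \rank B = r >].
have P0 : exists r, P r.
  exists 0%N; apply/asboolP; exists 0%N, 0; split; first by case.
  by rewrite mxrank0.
have Pm r : P r -> (r <= m)%N.
  by move=> /asboolP[k [B [_ <-]]]; exact: rank_leq_col.
case: (ex_maxnP P0 Pm) => r /asboolP[k [B [KB rB]]] rmax.
exists k, B; split => // y Ky; apply: contrapT => /negP yB.
have : P (\rank (col_mx y B)).
  apply/asboolP; exists (1 + k)%N, (col_mx y B); split => // i.
  case: (split_ordP i) => j ->; last by rewrite rowKd.
  by rewrite rowKu row_id.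
move=> /rmax; rewrite leqNgt -rB => /negP; apply.
rewrite ltn_neqAle mxrankS ?andbT; last first.
  by rewrite -addsmxE addsmxSr.
have BS : (B <= col_mx y B)%MS by rewrite -addsmxE addsmxSr.
have [_ ->] := mxrank_leqif_sup BS.
by rewrite col_mx_sub (negPf yB).
Qed.

(** A vector outside the span of [K] is detected by a column of the cokernel
    of the spanning matrix; and a vector of the span is a difference of
    elements of the cone, by separating the positive and negative
    coefficients. *)
Lemma biorthogonal_cone K z : K 0 ->
  (forall u v, K u -> K v -> K (u + v)) ->
  (forall (a : R) u, 0 <= a -> K u -> K (a *: u)) ->
  (forall p, (forall y, K y -> dot y p = 0) -> dot z p = 0) ->
  exists a b, [/\ K a, K b & z = a - b].
Proof.
move=> K0 KD KZ Hz.
have [k [B [KB BK]]] := spanning_rows K.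
have dotcol (y : 'rV[R]_m) j :
    dot y (col j (cokermx B))^T = (y *m cokermx B) 0 j.
  by rewrite /dot trmxK !mxE; apply: eq_bigr => i _; rewrite mxE.
have /submxP[D zE] : (z <= B)%MS.
  rewrite submxE; apply/eqP/rowP => j; rewrite [RHS]mxE -dotcol; apply: Hz => y.
  by move=> /BK; rewrite submxE => /eqP yB; rewrite dotcol yB mxE.
have Ksum (c : 'I_k -> R) : (forall i, 0 <= c i) -> K (\sum_i c i *: row i B).
  move=> c0; apply: (big_ind K) => // i _; exact: KZ.
exists (\sum_i Num.max (D 0 i) 0 *: row i B),
  (\sum_i Num.max (- D 0 i) 0 *: row i B).
split; [apply: Ksum|apply: Ksum|]; try by move=> i; rewrite le_max lexx orbT.
rewrite zE mulmx_sum_row -sumrB; apply: eq_bigr => i _.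
rewrite -scalerBl; congr (_ *: _).
by case: (leP (D 0 i) 0) => ?; case: (leP (- D 0 i) 0) => ?; lra.
Qed.

End cones.

(** * Affine hulls and orthogonal projections *)

Section affine_hulls.
Context {R : realType} {n : nat}.
Implicit Types (S : set 'rV[R]_n).

(** The origin absorbs the defect of the coefficients, so affine combinations
    are as good as linear ones. *)
Lemma affine_hull_linear S : S 0 -> exists (k : nat) (B : 'M[R]_(k, n)),
  affine_hull S = [set w | (w <= B)%MS].
Proof.
move=> S0; have [k [B [SB BS]]] := spanning_rows S.
exists k, B; apply/seteqP; split => w /=.
  move=> [j [a [s [Ss _ ->]]]].
  by apply: summx_sub => i _; apply: scalemx_sub; exact: BS.
move=> /submxP[D ->].
exists (k.+1), (fun i => oapp (D 0) (1 - \sum_j D 0 j) (unlift ord0 i)),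
  (fun i => oapp (fun j => row j B) 0 (unlift ord0 i)); split.
- by move=> i; case: (unliftP ord0 i) => [j _|_] /=.
- rewrite big_ord_recl unlift_none/=.
  rewrite [X in _ + X](eq_bigr (fun j => D 0 j)) ?subrK// => j _.
  by rewrite liftK.
- rewrite big_ord_recl unlift_none/= scaler0 add0r mulmx_sum_row.
  by apply: eq_bigr => i _; rewrite liftK.
Qed.

Lemma row_free_gram k (B : 'M[R]_(k, n)) : row_free B -> B *m B^T \in unitmx.
Proof.
move=> fB; rewrite -row_free_unit -kermx_eq0; apply/eqP/row_matrixP => i.
rewrite row0; set u := row i _.
have : u *m (B *m B^T) = 0 by rewrite -row_mul mulmx_ker row0.
move=> u0; have : dot (u *m B) (u *m B) = 0.
  by rewrite /dot trmx_mul !mulmxA -(mulmxA u) u0 mul0mx mxE.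
move=> /dot_eq0 uB.
by apply: (row_free_inj fB); rewrite uB mul0mx.
Qed.

(** The point is that the projection matrix exists, so that [orth_proj] is
    not its default value: for a row-free basis [C] of the subspace it is C^T
    (C C^T)^-1 C. *)
Lemma orth_proj_id S w : S 0 -> affine_hull S w ->
  w *m orth_proj (affine_hull S) = w /\
  (orth_proj (affine_hull S))^T = orth_proj (affine_hull S).
Proof.
move=> S0 Sw; rewrite /orth_proj.
have [k [B AE]] := affine_hull_linear S0.
case: xgetP => [P _ [PT PP PS]|noP].
  have : range (fun w => w *m P) w by rewrite PS.
  by move=> [u _ <-]; rewrite -mulmxA PP.
exfalso.
have [r [C [fC CB]]] : exists r (C : 'M[R]_(r, n)), row_free C /\ (C :=: B)%MS.
  exists (\rank B), (row_base B); split.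
    exact: row_base_free.
  exact: eq_row_base.
pose G := invmx (C *m C^T).
have GT : G^T = G by rewrite /G trmx_inv trmx_mul trmxK.
have CG : C *m C^T *m G = 1%:M by rewrite mulmxV// row_free_gram.
apply: (noP (C^T *m G *m C)); split.
- rewrite !trmx_mul trmxK GT.
  by rewrite mulmxA.
- by rewrite -!mulmxA (mulmxA C) (mulmxA (C *m C^T)) CG mul1mx.
rewrite AE; apply/seteqP; split => u /=.
  by move=> [v _ <-]; rewrite mulmxA (submx_trans (submxMl _ C))// CB.
rewrite -CB => /submxP[D ->]; exists (D *m C) => //.
by rewrite !mulmxA -(mulmxA D) -(mulmxA D) CG mulmx1.
Qed.

End affine_hulls.

(** * Moreau envelopes of a support function *)

Section penalty.
Context {R : realType} {m : nat}.
Variables (Q : set 'rV[R]_m) (P : 'rV[R]_m -> 'rV[R]_m).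
Hypothesis PQ : forall z, is_proj Q z (P z).

(** The Moreau envelope of the support function of [Q], written through the
    projection [P]: it is the maximum over [l] in [Q] of <l, z> - |l|^2 / (2
    c), attained at [P (c z)], which is therefore its gradient. *)
Definition envelope (c : R) (z : 'rV[R]_m) : R :=
  dot (P (c *: z)) z - dot (P (c *: z)) (P (c *: z)) / (2 * c).

(** The difference of the two sides is (2 c)^-1 times the squared norm of [mu
    - q - c (z' - z)], with [q] the projection, plus a term that is
    nonnegative by the variational inequality. It gives the maximality of [q]
    when [z' = z], and smoothness of the envelope when [mu] is the maximiser
    at [z']. *)
Lemma envelope_ub (c : R) mu z z' : 0 < c -> Q mu ->
  dot mu z' - dot mu mu / (2 * c) <=
  envelope c z + dot (P (c *: z)) (z' - z) + c / 2 * dot (z' - z) (z' - z).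
Proof.
move=> c0 Qmu; rewrite /envelope; have [_ /(_ _ Qmu)] := PQ (c *: z).
move: (P (c *: z)) => q h1.
have h2 := dot_ge0 (mu - q - c *: (z' - z)).
rewrite -subr_ge0.
have -> : dot q z - dot q q / (2 * c) + dot q (z' - z) +
   c / 2 * dot (z' - z) (z' - z) - (dot mu z' - dot mu mu / (2 * c)) =
   (2 * c)^-1 * (dot (mu - q - c *: (z' - z)) (mu - q - c *: (z' - z))
     - 2 * dot (c *: z - q) (mu - q)).
  rewrite !dot_lin (dotC mu q) (dotC z q) (dotC z' q) (dotC z mu) (dotC z' mu).
  rewrite (dotC z' z); field; exact: lt0r_neq0.
by rewrite mulr_ge0 ?invr_ge0//; lra.
Qed.

Lemma envelope_max (c : R) mu z : 0 < c -> Q mu ->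
  dot mu z - dot mu mu / (2 * c) <= envelope c z.
Proof.
by move=> c0 /envelope_ub-/(_ c z z c0); rewrite subrr !dot0r mulr0 !addr0.
Qed.

Lemma envelope_le (c : R) z z' : 0 < c ->
  envelope c z' <=
  envelope c z + dot (P (c *: z)) (z' - z) + c / 2 * dot (z' - z) (z' - z).
Proof. by move=> c0; apply: envelope_ub => //; have [] := PQ (c *: z'). Qed.

Lemma envelope_ge (c : R) z z' : 0 < c ->
  envelope c z + dot (P (c *: z)) (z' - z) <= envelope c z'.
Proof.
move=> c0; have [Qq _] := PQ (c *: z).
by apply: le_trans (envelope_max z' c0 Qq); rewrite dotBr /envelope; lra.
Qed.

Lemma envelope_cvg (c : R) (z : 'rV[R]_m) : 0 < c ->
  envelope c z' @[z' --> z] --> envelope c z.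
Proof.
move=> c0.
have lz : envelope c z + dot (P (c *: z)) (z' - z) @[z' --> z]
    --> envelope c z.
  rewrite -[X in _ --> X]addr0 -(dot0r (P (c *: z))) -[X in dot _ X](subrr z).
  apply: (@cvgD _ _ _ (nbhs z)); first exact: cvg_cst.
  apply: (@cvg_dot _ _ (nbhs z)); first exact: cvg_cst.
  by apply: (@cvgB _ _ _ (nbhs z)); [exact: cvg_id|exact: cvg_cst].
have uz : envelope c z + dot (P (c *: z)) (z' - z) +
    c / 2 * dot (z' - z) (z' - z) @[z' --> z] --> envelope c z.
  rewrite -[X in _ --> X]addr0 -(mulr0 (c / 2)) -(dot0r (0 : 'rV[R]_m)).
  apply: (@cvgD _ _ _ (nbhs z)); first exact: lz.
  apply: (@cvgM _ _ (nbhs z)); first exact: cvg_cst.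
  rewrite -(subrr z).
  by apply: (@cvg_dot _ _ (nbhs z)); apply: (@cvgB _ _ _ (nbhs z));
    [exact: cvg_id|exact: cvg_cst|exact: cvg_id|exact: cvg_cst].
apply: squeeze_cvgr lz uz.
by apply: nearW => z'; rewrite envelope_le// envelope_ge.
Qed.

End penalty.

(** * Approximate chain rule for regular subgradients *)

Lemma cvg_diff_quotient (R : realType) (n m : nat) (F : 'rV[R]_n -> 'rV[R]_m)
    x h : differentiable F x ->
  t^-1 *: (F (x + t *: h) - F x) @[t --> (0 : R)^'+] --> h *m 'J F x.
Proof.
move=> dF; rewrite -deriveEjacobian//.
apply: cvg_dnbhs_at_right.
under eq_fun do rewrite (addrC x).
exact: (@diff_derivable _ _ _ _ _ h dF).
Qed.

Section chain_rule.
Context {R : realType} {n m : nat}.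
Variables (Q : set 'rV[R]_m) (F : 'rV[R]_n -> 'rV[R]_m).
Variables (phi : 'rV[R]_n -> \bar R) (b : R).
Hypotheses (clQ : closed Q) (cQ : convex_set Q) (Q0 : Q !=set0).

(** The support function is replaced by its Moreau envelope with parameter
    [c]. By regularity of [v], the function envelope (F y) - <v, y - x> + 2 e
    |y - x| has minimisers over a ball that tend to [x] as [c] grows. At such
    a minimiser the envelope is smooth with gradient [l] in [Q], and
    stationarity says that DF^T l is within 2 e of [v]. The projection
    inequality makes [l] almost maximal for <., F>. *)
Lemma fuzzy_chain_rule (x v : 'rV[R]_n) (eta : R) :
  (\forall y \near x, phi y = (b%:E + support_fun Q (F y))%E) ->
  (\forall y \near x, differentiable F y) ->
  regular_subdiff phi x v -> 0 < eta ->
  exists x' l, [/\ enorm (x' - x) < eta, Q l,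
    enorm (l *m ('J F x')^T - v) <= eta &
    forall mu, Q mu -> dot (F x') (mu - l) <= eta * dot mu mu].
Proof.
move=> phiE dF [phix vP] eta0.
pose e := eta / 2; have e0 : 0 < e by rewrite divr_gt0.
have phixE : phi x = (b%:E + support_fun Q (F x))%E.
  exact: nbhs_singleton phiE.
have sfin : support_fun Q (F x) \is a fin_num.
  by move: phix; rewrite phixE fin_numD => /andP[].
pose s := fine (support_fun Q (F x)).
have sE : support_fun Q (F x) = s%:E by rewrite fineK.
have sub mu : Q mu -> dot mu (F x) <= s.
  by move=> Qmu; rewrite -lee_fin -sE; apply: ereal_sup_ubound; exists mu.
(* the inequality that makes v a regular subgradient, freed of extended reals *)
have reg : \forall y \near x, forall c,
    (forall mu, Q mu -> dot mu (F y) <= c) ->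
    s + dot v (y - x) - e * enorm (y - x) <= c.
  apply: filterS2 phiE (vP _ e0) => y yE + c yc.
  have le : (support_fun Q (F y) <= c%:E)%E.
    by apply: ge_ereal_sup => _ [mu Qmu <-]; rewrite lee_fin yc.
  rewrite phixE sE yE => /le_trans-/(_ _ (leeD2l b%:E le)).
  by rewrite -!EFinD lee_fin => ?; lra.
have [P PQ] : {P : 'rV[R]_m -> 'rV[R]_m & forall z, is_proj Q z (P z)}.
  exact: (choice (fun z => ex_proj z clQ cQ Q0)).
have dreg : \forall y \near x, differentiable F y /\
    forall c, (forall mu, Q mu -> dot mu (F y) <= c) ->
      s + dot v (y - x) - e * enorm (y - x) <= c by exact: filterI.
have /nbhs_normP[d0 d00 dP] := dreg.
pose d := d0 / 2; have d_gt0 : 0 < d by rewrite divr_gt0.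
have {dP}dP y : `|y - x| <= d -> differentiable F y /\
    forall c, (forall mu, Q mu -> dot mu (F y) <= c) ->
      s + dot v (y - x) - e * enorm (y - x) <= c.
  move=> yd; apply: dP => /=; rewrite distrC (le_lt_trans yd)//.
  by rewrite ltr_pdivrMr// ltr_pMr// ltr1n.
pose K := [set y : 'rV[R]_n | `|y - x| <= d].
have clK : closed K.
  apply: (@preimage_closed _ _ (fun y : 'rV[R]_n => `|y - x|) [set r | r <= d]).
    move=> y _; apply: (@cvg_norm _ _ _ (nbhs y)).
    by apply: (@cvgB _ _ _ (nbhs y)); [exact: cvg_id|exact: cvg_cst].
  exact: closed_le.
have Kb y : K y -> `|y| <= d + `|x|.
  move=> Ky; rewrite -(subrK x y) (le_trans (ler_normD _ _))//.
  by rewrite lerD2r.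
have cK : compact K.
  apply: bounded_closed_compact clK; exists (d + `|x|); split.
    exact: num_real.
  by move=> M dM y /Kb /le_trans; apply; exact: ltW.
pose f (k : nat) (y : 'rV[R]_n) :=
  envelope P k.+1%:R (F y) - dot v (y - x) + 2 * e * enorm (y - x).
have cf k : {within K, continuous (f k)}.
  apply: continuous_in_subspaceT => y; rewrite inE => Ky.
  have [dFy _] := dP _ Ky.
  apply: (@cvgD _ _ _ (nbhs y)).
    apply: (@cvgB _ _ _ (nbhs y)).
      apply: (@continuous_cvg _ _ _ (nbhs y) _ F (envelope P k.+1%:R)).
        exact: (envelope_cvg PQ).
      exact: differentiable_continuous.
    apply: (@cvg_dot _ _ (nbhs y)); first exact: cvg_cst.
    by apply: (@cvgB _ _ _ (nbhs y)); [exact: cvg_id|exact: cvg_cst].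
  apply: (@cvgM _ _ (nbhs y)); first exact: cvg_cst.
  apply: (@cvg_enorm _ _ (nbhs y)).
  by apply: (@cvgB _ _ _ (nbhs y)); [exact: cvg_id|exact: cvg_cst].
have Kx : K x by rewrite /K /= subrr normr0 ltW.
have /choice[xs xsP] k : exists z, K z /\ forall y, K y -> f k z <= f k y.
  have [y] := @EVT_min_rV R n (f k) K (ex_intro _ x Kx) cK (cf k).
  rewrite inE => Ky ymin; exists y; split => // y' Ky'.
  by apply: ymin; rewrite inE.
(* comparison of the minimiser with x, using mu as a competitor in the
   envelope *)
have xs_s mu k : Q mu -> dot mu (F (xs k)) - dot mu mu / (2 * k.+1%:R) -
    dot v (xs k - x) + 2 * e * enorm (xs k - x) <= s.
  move=> Qmu; have [_ /(_ _ Kx)] := xsP k; rewrite /f subrr dot0r enorm0.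
  have := envelope_max PQ (F (xs k)) (ltr0Sn R k) Qmu.
  suff h1 : envelope P k.+1%:R (F x) <= s.
    move=> h2 h3; rewrite subr0 mulr0 addr0 in h3.
    by apply: le_trans h1; apply: le_trans h3; rewrite !lerD2r.
  rewrite /envelope; set q := P _.
  have Qq : Q q by have [] := PQ (k.+1%:R *: F x).
  have := sub _ Qq; suff qq : 0 <= dot q q / (2 * k.+1%:R).
    by move=> h; apply: le_trans h; rewrite gerBl.
  by rewrite divr_ge0// dot_ge0.
have [U [UU ooU]] := ultraFilterLemma (eventually_filter).
have [y Ky xsy] : exists2 y, K y & xs k @[k --> U] --> y.
  apply: (compact_cvg_ultra UU cK); apply: filterE => k.
  by have [] := xsP k.
have hU : @harmonic R k @[k --> U] --> 0.
  by move=> V /cvg_harmonic; exact: ooU.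
have [dFy regy] := dP _ Ky.
have xsxU : xs k - x @[k --> U] --> y - x by apply: cvgB => //; exact: cvg_cst.
(* in the limit the 2 e of the penalty beats the e of regularity *)
have yx : enorm (y - x) = 0.
  apply: le_anti; rewrite enorm_ge0 andbT.
  have : s + dot v (y - x) - e * enorm (y - x) <=
         s + dot v (y - x) - 2 * e * enorm (y - x).
    apply: regy => mu Qmu.
    suff : dot mu (F y) - dot mu mu / 2 * 0 - dot v (y - x)
      + 2 * e * enorm (y - x) <= s by lra.
    apply: (@cvgr_to_le _ U _ _ (fun k => dot mu (F (xs k)) -
      dot mu mu / 2 * harmonic k - dot v (xs k - x) +
      2 * e * enorm (xs k - x))).
      apply: cvgD.
        apply: cvgB.
          apply: cvgB.
            apply: cvg_dot; first exact: cvg_cst.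
            apply: continuous_cvg xsy; exact: differentiable_continuous.
          by apply: cvgM => //; exact: cvg_cst.
        by apply: cvg_dot => //; exact: cvg_cst.
      by apply: cvgM; [exact: cvg_cst|exact: cvg_enorm].
    apply: filterE => k; have := xs_s mu k Qmu.
    by rewrite /harmonic /= invfM mulrA.
  by rewrite lerD2l lerN2 -mulrA; move: (enorm _) e0 => a e0 H; nra.
have {yx}yx : y = x by apply/subr0_eq/enorm_eq0.
have xs0 : xs k - x @[k --> U] --> (0 : 'rV[R]_n) by rewrite -(subrr x) -{2}yx.
have nearxs : U [set k | enorm (xs k - x) < eta].
  by apply: (cvgr_lt _ (cvg_enorm xs0)); rewrite enorm0.
have nearxs' : U [set k | `|xs k - x| < d] by exact: (cvgr0_norm_lt _ xs0).
have nearh : U [set k | harmonic k < eta] by exact: (cvgr_lt _ hU).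
have [k [[k1 k2] k3]] := filter_ex (filterI (filterI nearxs nearxs') nearh).
set x' := xs k in k1 k2; set c : R := k.+1%:R; have c0 : 0 < c by [].
pose l := P (c *: F x').
have [Ql lP] : is_proj Q (c *: F x') l by exact: PQ.
exists x', l; split => //; last first.
  move=> mu Qmu; have := lP _ Qmu; rewrite dotBl dotZl => h1.
  have h2 : dot l (mu - l) <= dot mu mu.
    have := dot_ge0 (mu - l); rewrite !dot_lin (dotC mu l).
    by have := dot_ge0 mu; have := dot_ge0 l; lra.
  have h3 : c * dot (F x') (mu - l) <= c * (eta * dot mu mu).
    rewrite (le_trans (y := dot mu mu))//; first by lra.
    have : 1 <= c * eta.
      have <- : c / c = 1 by rewrite divff// gt_eqF.
      by rewrite ler_pM2l//; exact: (ltW k3).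
    by have := dot_ge0 mu; nra.
  by rewrite -(ler_pM2l c0).
have dFx' : differentiable F x' by have [] := dP x' (ltW k2).
(* stationarity is tested in the direction of the residual itself *)
set J := 'J F x'; pose h := v - l *m J^T.
have hJ : dot l (h *m J) = dot (l *m J^T) h.
  by rewrite /dot trmx_mul mulmxA.
have : 0 <= dot l (h *m J) + c / 2 * (0 * dot (h *m J) (h *m J)) - dot v h +
    2 * e * enorm h.
  pose g (t : R) := t^-1 *: (F (x' + t *: h) - F x').
  have cg : g t @[t --> 0^'+] --> h *m J by exact: cvg_diff_quotient.
  apply: (@cvgr_to_ge _ (0^'+) _ _ (fun t => dot l (g t) +
    c / 2 * (t * dot (g t) (g t)) - dot v h + 2 * e * enorm h)).
    apply: cvgD; last exact: cvg_cst.
    apply: cvgB; last exact: cvg_cst.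
    apply: cvgD; first by apply: cvg_dot cg; exact: cvg_cst.
    apply: cvgM; first exact: cvg_cst.
    apply: cvgM; last exact: cvg_dot.
    by apply: cvg_at_right_filter; exact: cvg_id.
  have id0 : (id : R -> R) t @[t --> 0^'+] --> (0 : R).
    by apply: cvg_at_right_filter; exact: cvg_id.
  have th : \forall t \near (0 : R)^'+, t * `|h| < d - `|x' - x|.
    apply: (cvgr_lt (0 * `|h|)); last by rewrite mul0r subr_gt0.
    by apply: cvgM; [exact: id0|exact: cvg_cst].
  near=> t.
  have t0 : 0 < t by near: t; exact: nbhs_right_gt.
  have Kt : K (x' + t *: h).
    rewrite /K /= addrAC (le_trans (ler_normD _ _))// normrZ gtr0_norm//.
    by rewrite -lerBrDl ltW//; near: t.
  have [_ /(_ _ Kt)] := xsP k; rewrite -/x' /f -/c.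
  rewrite [x' + _ - x]addrAC; move: (x' - x) => u; rewrite dotDr dotZr.
  have gE : F (x' + t *: h) - F x' = t *: g t.
    by rewrite /g scalerA divff ?gt_eqF// scale1r.
  move: (g t) gE => w gE.
  have := envelope_le PQ (F x') (F (x' + t *: h)) c0.
  have := enormD u (t *: h); rewrite enormZ gtr0_norm//.
  rewrite gE !dotZl !dotZr -/l => H1 H2 H3.
  have : 0 <= t * (dot l w + c / 2 * (t * dot w w) - dot v h +
      2 * e * enorm h).
    have : 2 * e * enorm (u + t *: h) <=
        2 * e * (enorm u + t * enorm h).
      by rewrite ler_pM2l// mulr_gt0.
    by lra.
  by rewrite pmulr_rge0.
rewrite hJ mul0r mulr0 addr0 -dotBl -[l *m J^T - v]opprB -/h dotNl -enorm_sqr.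
move=> hh; rewrite enormN.
have [->|h0] := eqVneq (enorm h) 0; first exact: ltW.
have hg : 0 < enorm h by rewrite lt_def h0 enorm_ge0.
by rewrite -(ler_pM2r hg) -expr2; rewrite /e in hh; lra.
Unshelve. all: by end_near.
Qed.
End chain_rule.

(** * Stability of multipliers *)

Section multiplier_bound.
Context {R : realType}.

Lemma normr_mulmx (m n p : nat) (A : 'M[R]_(m, n)) (B : 'M[R]_(n, p)) :
  `|A *m B| <= n%:R * (`|A| * `|B|).
Proof.
apply: normr_mx_le => [|i j]; first by rewrite !mulr_ge0.
rewrite mxE (le_trans (ler_norm_sum _ _ _))//.
rewrite -[X in X%:R]card_ord -sumr_const mulr_suml mul1r ler_sum// => k _.
by rewrite normrM ler_pM// normr_coord.
Qed.

Lemma normr_trmx (m n : nat) (A : 'M[R]_(m, n)) : `|A^T| <= `|A|.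
Proof. by apply: normr_mx_le => // i j; rewrite mxE normr_coord. Qed.

Lemma normr_dot (n : nat) (u v : 'rV[R]_n) : `|dot u v| <= n%:R * (`|u| * `|v|).
Proof.
rewrite (le_trans (normr_coord _ _ _))// (le_trans (normr_mulmx _ _))//.
by rewrite ler_wpM2l// ler_wpM2l// normr_trmx.
Qed.

(** Every [u] is [h J - n] with [n] normal to [Q] at [lbar], whence <l -
    lbar, u> >= <(l - lbar) J^T, h> for [l] in [Q]. Taking for [u] the
    coordinate vectors and their opposites bounds [l - lbar] by (l - lbar)
    J^T, and replacing [J] by a close [X] costs a term that the left-hand
    side absorbs. *)
Lemma multiplier_bound (n m : nat) (Q : set 'rV[R]_m) (lbar : 'rV[R]_m)
    (J : 'M[R]_(n, m)) :
  [set a - b | a in range (fun h => h *m J) & b in normal_cone Q lbar] = setT ->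
  exists2 C : R, 0 < C & forall l X, Q l -> C * `|X - J| <= 2^-1 ->
    `|l - lbar| <= 2 * C * (`|l *m X^T - lbar *m J^T| + `|lbar| * `|X - J|).
Proof.
move=> CQ.
have /choice[h hP] (u : 'rV[R]_m) : exists h : 'rV[R]_n, forall l, Q l ->
    dot ((l - lbar) *m J^T) h <= dot (l - lbar) u.
  have : [set a - b | a in range (fun h => h *m J) & b in normal_cone Q lbar] u.
    by rewrite CQ.
  move=> [_ [h _ <-] [b [_ Nb] <-]]; exists h => l Ql.
  rewrite dotBr (dotC _ b) {1}/dot -mulmxA -trmx_mul -/(dot _ _).
  by have := Nb _ Ql; lra.
pose C0 : R := \sum_(i < m)
  (n%:R * (`|h (delta_mx 0 i)| + `|h (- delta_mx 0 i)|)).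
have C00 : 0 <= C0 by apply: sumr_ge0 => i _; rewrite mulr_ge0// addr_ge0.
have dot_delta (u : 'rV[R]_m) i : dot u (delta_mx 0 i) = u 0 i.
  rewrite dotE (bigD1 i)//= mxE !eqxx mulr1 big1 ?addr0// => j ji.
  by rewrite mxE (negPf ji) andbF mulr0.
have coord l : Q l -> `|l - lbar| <= C0 * `|(l - lbar) *m J^T|.
  move=> Ql; apply: normr_mx_le => [|i0 i]; first by rewrite mulr_ge0.
  rewrite (ord1 i0).
  have Ci : n%:R * (`|h (delta_mx 0 i)| + `|h (- delta_mx 0 i)|) <= C0.
    rewrite /C0 (bigD1 i)//= lerDl; apply: sumr_ge0 => j _.
    by rewrite mulr_ge0// addr_ge0.
  apply: le_trans (ler_wpM2r (normr_ge0 _) Ci).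
  set w := (l - lbar) *m J^T.
  have hle u : dot w (h u) >= - (n%:R * (`|h u| * `|w|)).
    by have := normr_dot w (h u); rewrite ler_norml [`|w| * _]mulrC => /andP[].
  have e1 := hP (delta_mx 0 i) l Ql; have e2 := hP (- delta_mx 0 i) l Ql.
  rewrite dotNr !dot_delta -/w in e1 e2.
  have := hle (delta_mx 0 i); have := hle (- delta_mx 0 i).
  have p1 : 0 <= n%:R * (`|h (delta_mx 0 i)| * `|w|) by rewrite !mulr_ge0.
  have p2 : 0 <= n%:R * (`|h (- delta_mx 0 i)| * `|w|) by rewrite !mulr_ge0.
  by rewrite ler_norml => ? ?; apply/andP; split; lra.
(* m + 1 dominates both coefficients 1 and m that occur below, and the
   summand 1 makes the constant positive *)
exists (C0 * m.+1%:R + 1) => [|l X Ql Cx].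
  by rewrite ltr_wpDl// mulr_ge0.
set C := C0 * _ + 1 in Cx *; set x := `|X - J| in Cx *.
set a := `|l *m X^T - _|; set d := `|l - lbar|.
have wle : `|(l - lbar) *m J^T| <= a + m%:R * (`|l| * x).
  have -> : (l - lbar) *m J^T = (l *m X^T - lbar *m J^T) - l *m (X - J)^T.
    by rewrite raddfB /= mulmxBr mulmxBl opprB [RHS]addrC addrA subrK.
  rewrite (le_trans (ler_normB _ _))// lerD2l (le_trans (normr_mulmx _ _))//.
  by rewrite ler_wpM2l// ler_wpM2l// normr_trmx.
have lle : `|l| <= d + `|lbar| by rewrite -{1}(subrK lbar l) ler_normD.
have [x0 a0 d0] : [/\ 0 <= x, 0 <= a & 0 <= d] by split; exact: normr_ge0.
have b0 := normr_ge0 lbar.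
have h1 := coord _ Ql; rewrite -/d in h1.
have h2 : d <= C * (a + (d + `|lbar|) * x).
  apply: (le_trans h1); apply: (le_trans (ler_wpM2l C00 wle)).
  have : C0 * (a + m%:R * (`|l| * x)) <=
      C0 * (m.+1%:R * (a + (d + `|lbar|) * x)).
    rewrite ler_wpM2l// -natr1.
    have : `|l| * x <= (d + `|lbar|) * x by rewrite ler_wpM2r.
    have : 0 <= `|l| * x by rewrite mulr_ge0.
    have : 0 <= m%:R :> R by [].
    by move: (`|l| * x) ((d + _) * x) m%:R => y z M; nra.
  move=> /le_trans; apply; rewrite mulrA ler_wpM2r//; last by rewrite /C lerDl.
  by rewrite addr_ge0// mulr_ge0// addr_ge0.
have : C * x * d <= 2^-1 * d by rewrite ler_wpM2r.
lra.
Qed.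

End multiplier_bound.

(** * Chain rule for limiting subgradients *)

Section limiting_chain_rule.
Context {R : realType} {n m : nat}.
Variables (Q : set 'rV[R]_m) (F : 'rV[R]_n -> 'rV[R]_m).
Variables (phi : 'rV[R]_n -> \bar R) (b : R).
Hypotheses (clQ : closed Q) (cQ : convex_set Q) (Q0 : Q !=set0).

(** Approximate multipliers of nearby regular subgradients are bounded by
    hypothesis, and a limit of them along an ultrafilter is an exact
    multiplier. *)
Lemma limiting_chain_rule (x v : 'rV[R]_n) (a : R) :
  (\forall y \near x, phi y = (b%:E + support_fun Q (F y))%E) ->
  (\forall y \near x, differentiable F y) ->
  {for x, continuous (fun y => 'J F y)} ->
  (\forall y \near x, forall l, Q l -> `|l *m ('J F y)^T - v| <= 1 ->
    `|l| <= a) ->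
  subdiff phi x v ->
  exists l, [/\ Q l, v = l *m ('J F x)^T &
    forall mu, Q mu -> dot (F x) (mu - l) <= 0].
Proof.
move=> phiE dF cJ bnd [_ [xs [vs [xsx _ vP vsv]]]].
have xs_near (P : 'rV[R]_n -> Prop) : (\forall y \near x, P y) ->
    \forall k \near \oo, P (xs k) by move=> Px; exact: xsx Px.
have near_near : \forall k \near \oo,
    (\forall y \near xs k, phi y = (b%:E + support_fun Q (F y))%E) /\
    (\forall y \near xs k, differentiable F y).
  apply: (xs_near (fun z =>
    (\forall y \near z, phi y = (b%:E + support_fun Q (F y))%E) /\
    (\forall y \near z, differentiable F y))).
  exact: filterI (near_join phiE) (near_join dF).
have hg k : 0 < harmonic k :> R by rewrite invr_gt0.
have ex k : exists p : 'rV[R]_n * 'rV[R]_m,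
    (\forall y \near xs k, phi y = (b%:E + support_fun Q (F y))%E) /\
    (\forall y \near xs k, differentiable F y) ->
    [/\ enorm (p.1 - xs k) < harmonic k, Q p.2,
      enorm (p.2 *m ('J F p.1)^T - vs k) <= harmonic k &
      forall mu, Q mu -> dot (F p.1) (mu - p.2) <= harmonic k * dot mu mu].
  have [[H1 H2]|nH] := pselect ((\forall y \near xs k,
      phi y = (b%:E + support_fun Q (F y))%E) /\
      (\forall y \near xs k, differentiable F y)); last by exists 0.
  have [x' [l H]] := fuzzy_chain_rule clQ cQ Q0 H1 H2 (vP k) (hg k).
  by exists (x', l).
have {ex}[p pP] := choice ex.
have {near_near}pP : \forall k \near \oo,
    [/\ enorm ((p k).1 - xs k) < harmonic k, Q (p k).2,
      enorm ((p k).2 *m ('J F (p k).1)^T - vs k) <= harmonic k &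
      forall mu, Q mu ->
        dot (F (p k).1) (mu - (p k).2) <= harmonic k * dot mu mu].
  by apply: filterS near_near => k /pP.
have p1x : (p k).1 @[k --> \oo] --> x.
  rewrite -[X in _ --> X]add0r.
  have -> : (fun k => (p k).1) = (fun k => (p k).1 - xs k + xs k).
    by apply/funext => k; rewrite subrK.
  apply: (@cvgD _ _ _ \oo) => //.
  apply: (@cvg_mx_enorm _ _ \oo _ _ _ harmonic); last exact: cvg_harmonic.
  by apply: filterS pP => k [/ltW]; rewrite subr0.
have p2v : (p k).2 *m ('J F (p k).1)^T @[k --> \oo] --> v.
  rewrite -[X in _ --> X]add0r.
  have -> : (fun k => (p k).2 *m ('J F (p k).1)^T) =
      (fun k => (p k).2 *m ('J F (p k).1)^T - vs k + vs k).
    by apply/funext => k; rewrite subrK.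
  apply: (@cvgD _ _ _ \oo) => //.
  apply: (@cvg_mx_enorm _ _ \oo _ _ _ harmonic); last exact: cvg_harmonic.
  by apply: filterS pP => k []; rewrite subr0.
have pb : \forall k \near \oo, `|(p k).2| <= a.
  have h1 : \forall k \near \oo, forall l, Q l ->
    `|l *m ('J F (p k).1)^T - v| <= 1 -> `|l| <= a by exact: p1x bnd.
  have h2 := @cvgr_distC_le _ _ _ \oo _ _ _ p2v _ ltr01.
  near=> k.
  have [_ Qk _ _] : [/\ enorm ((p k).1 - xs k) < harmonic k, Q (p k).2,
      enorm ((p k).2 *m ('J F (p k).1)^T - vs k) <= harmonic k &
      forall mu, Q mu ->
        dot (F (p k).1) (mu - (p k).2) <= harmonic k * dot mu mu].
    by near: k; exact: pP.
  have h1k : forall l, Q l -> `|l *m ('J F (p k).1)^T - v| <= 1 -> `|l| <= a.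
    by near: k; exact: h1.
  by apply: h1k => //; near: k; exact: h2.
have [U [UU ooU]] := ultraFilterLemma (eventually_filter).
have [l pl] := bounded_cvg_ultra UU (ooU _ pb).
have JU : 'J F (p k).1 @[k --> U] --> 'J F x.
  apply: (@continuous_cvg _ _ _ U _ (fun k => (p k).1) (fun y => 'J F y)) => //.
  by move=> V /p1x; exact: ooU.
exists l; split.
- apply: (@closed_cvg _ _ U _ (fun k => (p k).2) Q clQ _ l pl).
  by apply: ooU; apply: filterS pP => k [].
- apply: (@norm_cvg_unique _ _ ((p k).2 *m ('J F (p k).1)^T @[k --> U])).
    by move=> V /p2v; exact: ooU.
  exact: (cvg_mulmx pl (cvg_trmx JU)).
move=> mu Qmu; rewrite -(mul0r (dot mu mu)).
have FU : F (p k).1 @[k --> U] --> F x.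
  apply: (@continuous_cvg _ _ _ U _ (fun k => (p k).1) F) => //.
    by apply: differentiable_continuous; exact: (nbhs_singleton dF).
  by move=> V /p1x; exact: ooU.
have hU : @harmonic R k * dot mu mu @[k --> U] --> 0 * dot mu mu.
  apply: cvgM; last exact: cvg_cst.
  by move=> V /cvg_harmonic; exact: ooU.
rewrite -subr_ge0.
apply: (@cvgr_to_ge _ U _ _ (fun k => harmonic k * dot mu mu -
    dot (F (p k).1) (mu - (p k).2))).
  apply: (cvgB hU); apply: cvg_dot => //.
  by apply: cvgB => //; exact: cvg_cst.
by apply: ooU; apply: filterS pP => k [_ _ _ H]; rewrite subr_ge0 H.
Unshelve. all: by end_near.
Qed.

End limiting_chain_rule.

(** The chain rule for the identity map, where the multiplier is the
    subgradient itself. *)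
Lemma support_subdiff (R : realType) (m : nat) (Q : set 'rV[R]_m)
    (y l : 'rV[R]_m) :
  closed Q -> convex_set Q -> Q !=set0 -> subdiff (support_fun Q) y l ->
  Q l /\ forall mu, Q mu -> dot y (mu - l) <= 0.
Proof.
move=> clQ cQ Q0 sl.
have Jid z : 'J (id : 'rV[R]_m -> 'rV[R]_m) z = 1%:M.
  rewrite /jacobian; apply/row_matrixP => i; rewrite !rowE mul_rV_lin1 mulmx1.
  by rewrite diff_val.
have [||||//|l' [Ql']] := @limiting_chain_rule _ _ _ Q id (support_fun Q) 0
  clQ cQ Q0 y l (`|l| + 1).
- by apply: (@filterE _ (nbhs y)) => z; rewrite add0e.
- by apply: (@filterE _ (nbhs y)) => z.
- have -> : (fun z => 'J (id : 'rV[R]_m -> 'rV[R]_m) z) = (fun=> 1%:M).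
    by apply/funext => z; exact: Jid.
  exact: cst_continuous.
- apply: (@filterE _ (nbhs y)) => z l' _; rewrite Jid trmx1 mulmx1 => l'l.
  by rewrite -(subrK l l') (le_trans (ler_normD _ _))// addrC lerD2l.
by rewrite Jid trmx1 mulmx1 => -> H; split.
Qed.

(** * Second-order Taylor expansion *)

Section calculus.
Context {R : realType} {n : nat}.
Implicit Types (x u v w : 'rV[R]_n).

Lemma derive_grad (f : 'rV[R]_n -> R) x v :
  differentiable f x -> 'D_v f x = dot v (grad f x).
Proof.
move=> df; rewrite deriveE// [in LHS](row_sum_delta v) linear_sum dotE.
by apply: eq_bigr => i _; rewrite linearZ /= mxE deriveE.
Qed.

Lemma differentiable_row m (F : 'rV[R]_n -> 'rV[R]_m) x :
  (forall i, differentiable (fun y => F y 0 i) x) -> differentiable F x.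
Proof.
move=> dF.
have -> : F = \sum_i (fun y => F y 0 i *: (delta_mx 0 i : 'rV[R]_m)).
  by apply/funext => y; rewrite [LHS]row_sum_delta fct_sumE.
by apply: differentiable_sum => i; exact: differentiableZl.
Qed.

Lemma mul_jacobian m (F : 'rV[R]_n -> 'rV[R]_m) x v i :
  differentiable F x -> (v *m 'J F x) 0 i = dot v (grad (fun y => F y 0 i) x).
Proof.
move=> dF; rewrite -deriveEjacobian// derive_mx ?mxE; last first.
  exact: diff_derivable.
apply: derive_grad.
exact: (differentiable_comp dF (differentiable_coord _ _ _)).
Qed.

Lemma continuous_jacobian m (F : 'rV[R]_n -> 'rV[R]_m) x :
  (\forall y \near x, differentiable F y) ->
  (forall i, {for x, continuous (grad (fun y => F y 0 i))}) ->
  {for x, continuous (fun y => 'J F y)}.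
Proof.
move=> dF cg.
have JE y (i : 'I_n) j : differentiable F y ->
    'J F y i j = grad (fun z => F z 0 j) y 0 i.
  move=> dFy; have := mul_jacobian (delta_mx 0 i) j dFy.
  rewrite -rowE mxE => ->; rewrite dotC dotE (bigD1 i)//= big1 ?addr0.
    by rewrite [X in _ * X]mxE !eqxx mulr1.
  by move=> k ki; rewrite [X in _ * X]mxE (negPf ki) andbF mulr0.
apply: (@cvg_mx R _ (nbhs x) _ n m (fun y => 'J F y) ('J F x)) => i j.
have dFx : differentiable F x by exact: (nbhs_singleton dF).
have E := JE x i j dFx.
rewrite [in X in _ --> X]E.
have H : grad (fun z => F z 0 j) y 0 i @[y --> x] -->
    grad (fun z => F z 0 j) x 0 i.
  exact: (@cvg_coord R _ (nbhs x) _ _ _ _ _ 0 i (cg j)).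
apply: (cvg_trans _ H); apply: near_eq_cvg.
by apply: filterS dF => y dFy; exact/esym/JE.
Qed.

Lemma quad_dot (A : 'M[R]_n) u : quad A u = dot (u *m A) u.
Proof. by []. Qed.

Lemma derive_line (f : 'rV[R]_n -> R) x u (s : R) :
  differentiable f (x + s *: u) ->
  is_derive s 1 (fun s => f (x + s *: u)) (dot u (grad f (x + s *: u))).
Proof.
move=> df.
have E : (fun h : R => h^-1 *: (((fun s => f (x + s *: u)) \o shift s) (h *: 1)
      - f (x + s *: u))) =
    (fun h : R => h^-1 *: ((f \o shift (x + s *: u)) (h *: u) -
      f (x + s *: u))).
  apply/funext => h; rewrite /= [h *: 1]mulr1 scalerDl.
  by rewrite [in RHS]addrCA.
split; first by rewrite /derivable E; exact: diff_derivable.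
by rewrite /derive E -derive_grad.
Qed.

(** The mean value theorem on the segment from [x] to [x + u], applied to the
    remainder, only uses the first-order expansion of the gradient at [x]. *)
Lemma taylor2 (f : 'rV[R]_n -> R) x (e : R) :
  (\forall y \near x, differentiable f y) -> differentiable (grad f) x ->
  0 < e -> \forall u \near (0 : 'rV[R]_n),
    `|f (x + u) - f x - dot u (grad f x) - quad (hess f x) u / 2| <=
      e * `|u| ^+ 2.
Proof.
move=> df dg e0.
pose e' := e / n.+1%:R; have e'0 : 0 < e' by rewrite divr_gt0.
have dgx : \forall u \near (0 : 'rV[R]_n),
    `|grad f (x + u) - grad f x - u *m hess f x| <= e' * `|u|.
  have /eqaddoP/(_ _ e'0) := diff_locally dg.
  apply: filterS => u; rewrite /= !fctE /= [u + x]addrC opprD addrA.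
  by rewrite /hess /jacobian mul_rV_lin1.
have dfx : \forall u \near (0 : 'rV[R]_n), differentiable f (x + u).
  have xu : x + u @[u --> (0 : 'rV[R]_n)] --> x.
    rewrite -[X in _ --> X]addr0.
    by apply: (@cvgD _ _ _ (nbhs _)); [exact: cvg_cst|exact: cvg_id].
  exact: xu df.
have H : \forall u \near (0 : 'rV[R]_n), differentiable f (x + u) /\
    `|grad f (x + u) - grad f x - u *m hess f x| <= e' * `|u|.
  exact: filterI.
have /nbhs_normP[d d0 dP] := H.
apply/nbhs_normP; exists d => // u /=; rewrite sub0r normrN => ud.
have su (s : R) : s \in `[0, 1] -> `|s *: u| < d.
  rewrite in_itv/= => /andP[s0 s1]; apply: le_lt_trans ud.
  by rewrite normrZ ger0_norm// ler_piMl.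
pose a := dot u (grad f x); pose b := quad (hess f x) u.
pose g : R -> R := (fun s => f (x + s *: u)) - a *: id - (b / 2) *: (id ^+ 2).
have dgs (s : R) : s \in `[0, 1] -> is_derive s 1 g
    (dot u (grad f (x + s *: u)) - a - s * b).
  move=> /su sud; have [dfs _] : differentiable f (x + s *: u) /\
     `|grad f (x + s *: u) - grad f x - s *: u *m hess f x| <= e' * `|s *: u|.
    by apply: dP; rewrite /= sub0r normrN.
  have dl := derive_line dfs.
  apply: is_derive_eq.
  rewrite expr1 -[a%:A]/(a * 1) -[X in _ - X]/(b / 2 * (2 * s * 1)) !mulr1.
  by field.
have cg : {within `[0, 1], continuous g}.
  apply: continuous_in_subspaceT => s; rewrite inE => s01.
  have [dg1 _] := dgs s s01.
  by apply/differentiable_continuous/derivable1_diffP.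
have [c c01 gc] :=
  MVT_segment ler01 (fun s s01 => dgs s (subset_itv_oo_cc s01)) cg.
have [_] : differentiable f (x + c *: u) /\
     `|grad f (x + c *: u) - grad f x - c *: u *m hess f x| <= e' * `|c *: u|.
  by apply: dP; rewrite /= sub0r normrN su.
set r := _ - _ - _ => rle.
have g1 : g 1 - g 0 = f (x + u) - f x - a - b / 2.
  by rewrite /g !fctE /= scale1r scale0r addr0
    -[a *: 1]/(a * 1) -[a *: 0]/(a * 0)
    -[_ *: (1 ^+ 2)]/(_ * _) -[_ *: (0 ^+ 2)]/(_ * _) expr1n expr0n /=; ring.
rewrite -g1 gc subr0 mulr1.
have -> : dot u (grad f (x + c *: u)) - a - c * b = dot u r.
  by rewrite /r /a /b quad_dot !(dotBr, dotBl) -scalemxAl dotZr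
    (dotC u (u *m _)).
rewrite (le_trans (normr_dot _ _))//.
have c1 : `|c *: u| <= `|u|.
  move: c01; rewrite in_itv/= => /andP[c0 c1].
  by rewrite normrZ ger0_norm// ler_piMl.
have u0 := normr_ge0 u.
have rle' : `|r| <= e' * `|u| by rewrite (le_trans rle)// ler_wpM2l// ltW.
rewrite (le_trans (y := n%:R * (`|u| * (e' * `|u|))))//.
  by rewrite ler_wpM2l// ler_wpM2l.
have -> : n%:R * (`|u| * (e' * `|u|)) = n%:R * e' * `|u| ^+ 2 by ring.
rewrite ler_wpM2r ?exprn_ge0//.
rewrite /e' mulrCA ler_piMr ?(ltW e0)// ler_pdivrMr// mul1r ler_nat.
exact: leqnSn.
Qed.

(** Stated along an arbitrary filter because the directions and the step vary
    together in an epigraphical limit. *)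
Lemma taylor2_cvg {I : Type} {G : set_system I} {FG : Filter G}
    (f : 'rV[R]_n -> R) x (t : I -> R) (h : I -> 'rV[R]_n) w :
  (\forall y \near x, differentiable f y) -> differentiable (grad f) x ->
  t i @[i --> G] --> (0 : R) -> (\forall i \near G, 0 < t i) ->
  h i @[i --> G] --> w ->
  (2^-1 * t i ^+ 2)^-1 * (f (x + t i *: h i) - f x - t i * dot (h i) (grad f x))
    @[i --> G] --> quad (hess f x) w.
Proof.
move=> df dg t0 tgt hw.
have qh : quad (hess f x) (h i) @[i --> G] --> quad (hess f x) w.
  by apply: (@cvg_quad _ _ G) => //; exact: cvg_cst.
rewrite -[X in _ --> X]addr0.
pose r i := (2^-1 * t i ^+ 2)^-1 *
  (f (x + t i *: h i) - f x - t i * dot (h i) (grad f x)) -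
  quad (hess f x) (h i).
have -> : (fun i => (2^-1 * t i ^+ 2)^-1 *
  (f (x + t i *: h i) - f x - t i * dot (h i) (grad f x))) =
  (fun i => quad (hess f x) (h i) + r i).
  by apply/funext => i; rewrite /r [RHS]addrC subrK.
apply: (@cvgD _ _ _ G) => //.
apply/cvgr0Pnorm_le => e e0.
pose M := `|w| + 1; have M0 : 0 < M by rewrite ltr_wpDl.
pose e' := e / (2 * M ^+ 2).
have e'0 : 0 < e' by rewrite divr_gt0// mulr_gt0// exprn_gt0.
have th0 : t i *: h i @[i --> G] --> (0 : 'rV[R]_n).
  by rewrite -(scale0r w); exact: cvgZ.
have Tn : \forall i \near G,
    `|f (x + t i *: h i) - f x - dot (t i *: h i) (grad f x) -
    quad (hess f x) (t i *: h i) / 2| <= e' * `|t i *: h i| ^+ 2.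
  exact: (th0 _ (taylor2 df dg e'0)).
have hM : \forall i \near G, `|h i| <= M.
  apply: (@cvgr_norm_le _ _ _ G FG _ _ hw); first by rewrite ltrDl.
apply: filterS3 Tn hM tgt => i Ti hi ti.
rewrite /r.
have t2 : 0 < 2^-1 * t i ^+ 2 by rewrite mulr_gt0// exprn_gt0.
have -> : quad (hess f x) (h i) =
    (2^-1 * t i ^+ 2)^-1 * (quad (hess f x) (t i *: h i) / 2).
  rewrite !quad_dot -scalemxAl dotZl dotZr; field; exact: lt0r_neq0.
rewrite -mulrBr -dotZl normrM gtr0_norm ?invr_gt0// ler_pdivrMl//.
apply: (le_trans Ti); rewrite normrZ gtr0_norm// exprMn.
have : `|h i| ^+ 2 <= M ^+ 2 by rewrite ler_pXn2r// ?nnegrE// ltW.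
rewrite -(ler_pM2l (_ : 0 < e' * t i ^+ 2)); last first.
  by rewrite mulr_gt0// exprn_gt0.
rewrite -mulrA => /le_trans; apply.
rewrite le_eqVlt; apply/orP; left; apply/eqP; rewrite /e'; field.
exact: lt0r_neq0.
Qed.

End calculus.

(** * Lower bound on one second subderivative *)

Section second_order.
Context {R : realType} {n m : nat}.

Lemma C2_map_near (U : set 'rV[R]_n) (F : 'rV[R]_n -> 'rV[R]_m) x :
  open U -> U x -> C2_map_on U F -> \forall y \near x, differentiable F y.
Proof.
move=> oU Ux FU.
have : \forall y \near x, U y by exact: open_nbhs_nbhs.
by apply: filterS => y Uy; apply: differentiable_row => i; have [] := FU i y Uy.
Qed.

Lemma C2_map_continuous_jacobian (U : set 'rV[R]_n)
    (F : 'rV[R]_n -> 'rV[R]_m) x :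
  open U -> U x -> C2_map_on U F -> {for x, continuous (fun y => 'J F y)}.
Proof.
move=> oU Ux FU; apply: continuous_jacobian; first exact: (C2_map_near oU).
by move=> i; have [_ dg _] := FU i x Ux; exact: differentiable_continuous.
Qed.

Lemma taylor2_map_cvg {I : Type} {G : set_system I} {FG : Filter G}
    (U : set 'rV[R]_n) (F : 'rV[R]_n -> 'rV[R]_m) x
    (t : I -> R) (h : I -> 'rV[R]_n) (w : 'rV[R]_n) :
  open U -> U x -> C2_map_on U F ->
  t i @[i --> G] --> (0 : R) -> (\forall i \near G, 0 < t i) ->
  h i @[i --> G] --> w ->
  (2^-1 * t i ^+ 2)^-1 *: (F (x + t i *: h i) - F x - t i *: (h i *m 'J F x))
    @[i --> G] --> \row_j quad (hess (fun y => F y 0 j) x) w.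
Proof.
move=> oU Ux FU t0 tgt hw; apply: cvg_mx => i j; rewrite (ord1 i) !mxE.
have dFx : differentiable F x by exact: (nbhs_singleton (C2_map_near oU Ux FU)).
have -> : (fun i => ((2^-1 * t i ^+ 2)^-1 *:
      (F (x + t i *: h i) - F x - t i *: (h i *m 'J F x))) 0 j) =
    (fun i => (2^-1 * t i ^+ 2)^-1 * (F (x + t i *: h i) 0 j - F x 0 j -
      t i * dot (h i) (grad (fun y => F y 0 j) x))).
  by apply/funext => k; rewrite !mxE -mul_jacobian// mxE.
apply: (@taylor2_cvg _ _ _ G FG (fun y => F y 0 j)) => //.
  have : \forall y \near x, U y by exact: open_nbhs_nbhs.
  by apply: filterS => y Uy; have [] := FU j y Uy.
by have [] := FU j x Ux.
Qed.

Lemma dot_lagr_hess (F : 'rV[R]_n -> 'rV[R]_m) x l w :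
  dot l (\row_j quad (hess (fun y => F y 0 j) x) w) = quad (lagr_hess F x l) w.
Proof.
rewrite dotE /quad /lagr_hess mulmx_sumr mulmx_suml summxE.
by apply: eq_bigr => i _; rewrite mxE -scalemxAr -scalemxAl [RHS]mxE.
Qed.

(** Projecting the parabola onto [Q] turns a distance of order o(t^2) into an
    arc inside [Q]. *)
Lemma tangent2_seq (Q : set 'rV[R]_m) (l p r : 'rV[R]_m) :
  closed Q -> convex_set Q -> Q l -> tangent2 Q l p r ->
  exists (t : nat -> R) (rs : nat -> 'rV[R]_m),
    [/\ forall k, 0 < t k, t k @[k --> \oo] --> 0, rs k @[k --> \oo] --> r &
        forall k, Q (l + t k *: p + (t k ^+ 2 / 2) *: rs k)].
Proof.
move=> clQ cQ Ql [t [tgt t0 td]].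
pose z k := l + t k *: p + (t k ^+ 2 / 2) *: r.
have /choice[q qP] k : exists q, is_proj Q (z k) q.
  by apply: ex_proj => //; exists l.
pose rs k := r + (t k ^+ 2 / 2)^-1 *: (q k - z k).
have t2 k : 0 < t k ^+ 2 by rewrite exprn_gt0.
exists t, rs; split => //; last first.
  move=> k; rewrite /rs scalerDr addrA -/(z k) scalerA divff ?scale1r.
    by rewrite addrC subrK; have [] := qP k.
  by rewrite mulf_neq0// gt_eqF.
pose a k : R := enorm (z k - q k) / t k ^+ 2.
have a0 : a k @[k --> \oo] --> 0.
  suff : ((a k)%:E @[k --> \oo] --> 0%E) by move=> /fine_cvgP[].
  apply: (squeeze_cvge _ (cvg_cst _) td).
  apply: nearW => k; rewrite lee_fin divr_ge0 ?enorm_ge0 ?(ltW (t2 k))//=.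
  rewrite /a EFinM lee_wpmul2r ?lee_fin ?invr_ge0 ?(ltW (t2 k))//.
  apply: le_ereal_inf_tmp => _ [y Qy <-]; rewrite lee_fin.
  exact: is_proj_min.
apply: (@cvg_mx_enorm _ _ \oo _ _ _ (fun k => 2 * a k)).
  apply: nearW => k; rewrite /rs addrAC subrr add0r enormZ -(opprB (z k))
    enormN.
  rewrite gtr0_norm ?invr_gt0 ?divr_gt0// /a.
  have := tgt k; move: (t k) (enorm _) => s b s0.
  by rewrite le_eqVlt; apply/orP; left; apply/eqP; field; rewrite gt_eqF.
by rewrite -(mulr0 2); apply: cvgM => //; exact: cvg_cst.
Qed.

(** Since [phi] is at least [b + <mu, F>] for [mu] in [Q], with equality at
    [x] for [mu = l], moving [mu] along the arc l + s p + (s^2/2) r of [Q]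
    with [s = a t] bounds the difference quotient from below; the three terms
    are the limits of the three contributions. The arc exists only for a
    sequence of parameters [s]: twice epi-differentiability ensures that this
    sequence already sees the second subderivative, every point above it
    being a limit of points of the epigraphs along the full filter. *)
Lemma second_subderiv_ge (Q : set 'rV[R]_m) (U : set 'rV[R]_n)
    (F : 'rV[R]_n -> 'rV[R]_m) (phi : 'rV[R]_n -> \bar R) (b : R)
    (x v w : 'rV[R]_n) (l p r : 'rV[R]_m) (a : R) :
  closed Q -> convex_set Q -> open U -> U x -> C2_map_on U F ->
  (forall y, U y -> phi y = (b%:E + support_fun Q (F y))%E) ->
  Q l -> (forall mu, Q mu -> dot (F x) (mu - l) <= 0) ->
  v = l *m ('J F x)^T -> twice_epi_differentiable phi x v ->
  dot p (F x) = 0 -> tangent2 Q l p r -> 0 < a ->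
  ((a ^+ 2 * dot r (F x) + 2 * a * dot p (w *m 'J F x) +
    quad (lagr_hess F x l) w)%:E <= second_subderiv phi x v w)%E.
Proof.
move=> clQ cQ oU Ux FU phiE Ql lmax vE [hh [hinf hsup]] pF Tr a0.
set E := (X in (X%:E <= _)%E).
rewrite leNgt; apply/negP => ltE.
have [a1 lta1 a1E] : exists2 a1, (second_subderiv phi x v w < a1%:E)%E & a1 < E.
  move: ltE; case: (second_subderiv phi x v w) => [c|//|_].
    by rewrite lte_fin => cE; exists ((c + E) / 2); rewrite ?lte_fin; lra.
  by exists (E - 1); rewrite ?ltNyr//; lra.
pose D := diff_quot2 phi x v.
(* a1 exceeds the lower limit, so (w, a1) is in the outer limit of the
   epigraphs, which is also the inner one *)
have winf : pk_liminf (0 : R)^'+ (fun t => epigraph (D t)) (w, a1).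
  rewrite hinf -hsup => V [[V1 V2] /= [V1w V2a] V12] A A0.
  have : (ereal_inf ((fun p => D p.1 p.2) @` (A `*` V1)) < a1%:E)%E.
    apply: le_lt_trans lta1; rewrite /second_subderiv /epi_liminf limf_einfE.
    by apply: ereal_sup_ubound; exists (A `*` V1) => //; exists (A, V1).
  move=> /ereal_inf_lt[_ [[t h] /= [At V1h] <-] Dlt].
  exists t => //; exists (h, a1); split; first exact: ltW.
  by apply: V12; split => //; exact: nbhs_singleton V2a.
have [s [rs [sgt s0 rsr Qmu]]] := tangent2_seq clQ cQ Ql Tr.
pose t k := s k / a.
have tgt k : 0 < t k by rewrite divr_gt0.
have t0 : t k @[k --> \oo] --> 0.
  by rewrite -(mul0r a^-1); apply: cvgM => //; exact: cvg_cst.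
pose mu k := l + s k *: p + (s k ^+ 2 / 2) *: rs k.
pose G := filter_prod \oo (nbhs w).
have G1 (T : topologicalType) (u : nat -> T) (y : T) :
    u k @[k --> \oo] --> y -> u i.1 @[i --> G] --> y.
  by move=> uy; apply: cvg_comp uy; exact: cvg_fst.
have G2 : i.2 @[i --> G] --> w by exact: cvg_snd.
pose T (i : nat * 'rV[R]_n) := (2^-1 * t i.1 ^+ 2)^-1 *:
  (F (x + t i.1 *: i.2) - F x - t i.1 *: (i.2 *m 'J F x)).
have TG : T i @[i --> G] --> \row_j quad (hess (fun y => F y 0 j) x) w.
  apply: (taylor2_map_cvg oU Ux FU _ _ G2); first exact: G1 t0.
  exact: filterE.
have mul : mu k @[k --> \oo] --> l.
  have -> : l = l + 0 *: p + (0 ^+ 2 / 2) *: r.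
    by rewrite expr0n /= mul0r !scale0r !addr0.
  apply: cvgD; [apply: cvgD; first exact: cvg_cst|].
    by apply: cvgZ => //; exact: cvg_cst.
  apply: cvgZ => //; apply: cvgM; last exact: cvg_cst.
  by under eq_fun do rewrite expr2; rewrite expr2; exact: cvgM.
(* the lower bound on the quotient that the arc provides *)
pose X (i : nat * 'rV[R]_n) := a ^+ 2 * dot (rs i.1) (F x) +
  2 * a * dot (p + (s i.1 / 2) *: rs i.1) (i.2 *m 'J F x) + dot (mu i.1) (T i).
have XE : X i @[i --> G] --> E.
  rewrite /E -dot_lagr_hess; apply: cvgD; last first.
    by apply: cvg_dot => //; exact: (G1 _ mu).
  apply: cvgD.
    apply: cvgM; first exact: cvg_cst.
    by apply: cvg_dot; [exact: (G1 _ rs)|exact: cvg_cst].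
  apply: cvgM; first exact: cvg_cst.
  apply: cvg_dot; last by apply: cvg_mulmx => //; exact: cvg_cst.
  rewrite -[X in _ --> X]addr0 -(scale0r r) -(mul0r 2^-1).
  apply: (G1 _ (fun k => p + (s k / 2) *: rs k)).
  apply: cvgD; first exact: cvg_cst.
  by apply: cvgZ => //; apply: cvgM => //; exact: cvg_cst.
have Xgt : \forall i \near G, (a1 + E) / 2 < X i.
  by apply: (cvgr_gt _ XE); lra.
have xU : \forall i \near G, U (x + t i.1 *: i.2).
  have : x + t i.1 *: i.2 @[i --> G] --> x.
    rewrite -[X in _ --> X]addr0 -(scale0r w).
    apply: cvgD; first exact: cvg_cst.
    by apply: cvgZ => //; exact: (G1 _ t).
  by apply; exact: open_nbhs_nbhs.
have /= [[A V1] [Aoo V1w] AV] : G [set i | (a1 + E) / 2 < X i /\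
    U (x + t i.1 *: i.2)] by exact: filterI.
have Vw : nbhs (w, a1) (V1 `*` [set y | y < (a1 + E) / 2]).
  exists (V1, [set y | y < (a1 + E) / 2]) => //; split => //=.
  by apply: lt_nbhsl; lra.
have epik : \forall k \near \oo,
    epigraph (D (t k)) `&` (V1 `*` [set y | y < (a1 + E) / 2]) !=set0.
  have H := t0 _ (winf _ Vw).
  by apply: (@filterS _ \oo _ _ _ _ H) => k Hk; exact: Hk (tgt k).
have [k [Ak [[h y] [/= Dy [V1h yE]]]]] := filter_ex (filterI Aoo epik).
have [XhE xhU] := AV (k, h) (conj Ak V1h).
suff XD : ((X (k, h))%:E <= D (t k) h)%E.
  have := le_trans XD Dy; rewrite lee_fin => Xy.
  by have := lt_le_trans (lt_trans yE XhE) Xy; rewrite ltxx.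
have phix : phi x = (b + dot l (F x))%:E.
  rewrite phiE// EFinD; congr (_ + _)%E; apply/le_anti/andP; split.
    apply: ge_ereal_sup => _ [m' Qm' <-]; rewrite lee_fin.
    by have := lmax _ Qm'; rewrite dotBr !(dotC (F x)) subr_le0.
  by apply: ereal_sup_ubound; exists l.
have phixh : ((b + dot (mu k) (F (x + t k *: h)))%:E <= phi (x + t k *: h)%R)%E.
  rewrite phiE// EFinD leeD2l//.
  by apply: ereal_sup_ubound; exists (mu k) => //; exact: Qmu.
have t2 : 0 < 2^-1 * t k ^+ 2 by rewrite mulr_gt0// exprn_gt0.
rewrite /D /diff_quot2.
apply: (@le_trans _ _ (((b + dot (mu k) (F (x + t k *: h)))%:E - phi x -
    (t k * dot v h)%:E) * ((2^-1 * t k ^+ 2)^-1)%:E)%E); last first.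
  rewrite lee_wpmul2r ?lee_fin ?invr_ge0 ?(ltW t2)//.
  by do 2! apply: leeB => //.
rewrite phix -!EFinB -EFinM lee_fin ler_pdivlMr//.
have FE : F (x + t k *: h) =
    F x + t k *: (h *m 'J F x) + (2^-1 * t k ^+ 2) *: T (k, h).
  rewrite /T scalerA divff ?gt_eqF// scale1r.
  by rewrite /= -[F (x + _) - _ - _]addrA -opprD [RHS]addrC subrK.
have vh : dot v h = dot l (h *m 'J F x).
  by rewrite vE /dot trmx_mul mulmxA.
rewrite vh FE /X /= /mu.
have sE : s k = a * t k by rewrite /t mulrC divfK// gt_eqF.
move: (T (k, h)) (rs k) (h *m 'J F x) (F x) sE pF => T0 r0 u0 F0 -> pF.
rewrite !dot_lin pF le_eqVlt; apply/orP; left; apply/eqP; field.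
by [].
Qed.

End second_order.

(** * Lower epi-limit of the second subderivatives *)

Section lower_epi_limit.
Context {R : realType} {n m : nat}.
Variables (Q : set 'rV[R]_m) (U : set 'rV[R]_n) (F : 'rV[R]_n -> 'rV[R]_m).
Variables (phi : 'rV[R]_n -> \bar R) (b : R) (xbar : 'rV[R]_n).
Hypotheses (clQ : closed Q) (cQ : convex_set Q) (oU : open U) (Uxbar : U xbar).
Hypotheses (FU : C2_map_on U F) (Fxbar : F xbar = 0).
Hypothesis phiE : forall y, U y -> phi y = (b%:E + support_fun Q (F y))%E.

Lemma cvg_lagr_hess (I : Type) (G : set_system I) {FG : Filter G}
    (x : I -> 'rV[R]_n) (l : I -> 'rV[R]_m) (lbar : 'rV[R]_m) :
  x i @[i --> G] --> xbar -> l i @[i --> G] --> lbar ->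
  lagr_hess F (x i) (l i) @[i --> G] --> lagr_hess F xbar lbar.
Proof.
move=> xx ll; rewrite /lagr_hess.
apply: (@cvg_big 'M[R]_n _ _ _ predT _ _ G) => [N|j _].
  exact: add_continuous.
apply: cvgZ; first exact: cvg_coord.
have [_ _ ch] := FU j Uxbar.
exact: (@continuous_cvg _ _ _ G FG x (hess (fun y => F y 0 j))).
Qed.

Lemma tangent2_0 l : Q l -> tangent2 Q l 0 0.
Proof.
move=> Ql; exists harmonic; split; first by move=> k; rewrite invr_gt0.
  exact: cvg_harmonic.
have -> : (fun k =>
    (dist (l + @harmonic R k *: 0 + (harmonic k ^+ 2 / 2) *: 0)%R Q *
    ((harmonic k ^+ 2)^-1)%:E)%E) = cst 0%E; last exact: cvg_cst.
apply/funext => k; rewrite !scaler0 !addr0.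
suff -> : dist l Q = 0%E by rewrite mul0e.
apply/le_anti/andP; split.
  by apply: ereal_inf_lbound; exists l => //; rewrite subrr enorm0.
by apply: le_ereal_inf_tmp => _ [y _ <-]; rewrite lee_fin enorm_ge0.
Qed.

(** The previous bound is applied to a vector [q] of [L k] close to [p]. The
    second-order tangents belong to the unit vector q / |q|, which is why the
    parameter becomes a |q|; they are bounded by [M], and [F (x k)] tends to
    [F xbar = 0], so their contribution disappears. *)
Lemma epi_liminf_ge (x v : nat -> 'rV[R]_n) (l : nat -> 'rV[R]_m)
    (L : nat -> {vspace 'rV[R]_m}) (M a : R) (lbar p : 'rV[R]_m)
    (w : 'rV[R]_n) :
  x k @[k --> \oo] --> xbar -> l k @[k --> \oo] --> lbar ->
  (\forall k \near \oo, [/\ Q (l k),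
    (forall mu, Q mu -> dot (F (x k)) (mu - l k) <= 0),
    v k = l k *m ('J F (x k))^T & twice_epi_differentiable phi (x k) (v k)]) ->
  (\forall k \near \oo, [set` L k] `<=` lineality (tangent_cone Q (l k)) /\
    forall q, q \in L k -> enorm q = 1 ->
      (dist 0 (tangent2 Q (l k) q) < M%:E)%E) ->
  pk_liminf \oo (fun k => [set` L k]) p -> 0 < a ->
  ((2 * a * dot p (w *m 'J F xbar) + quad (lagr_hess F xbar lbar) w)%:E <=
    epi_liminf \oo (fun k => second_subderiv phi (x k) (v k)) w)%E.
Proof.
move=> xx ll lP LP pL a0.
set E := (X in (X%:E <= _)%E).
pose H := filter_prod \oo (nbhs w).
pose G := filter_prod H (nbhs p).
pose X (i : nat * 'rV[R]_n * 'rV[R]_m) :=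
  - (a ^+ 2 * enorm i.2 ^+ 2 * (M * enorm (F (x i.1.1)))) +
  2 * a * dot i.2 (i.1.2 *m 'J F (x i.1.1)) +
  quad (lagr_hess F (x i.1.1) (l i.1.1)) i.1.2.
have Gfst (T : topologicalType) (u : nat -> T) (y : T) :
    u k @[k --> \oo] --> y -> u i.1.1 @[i --> G] --> y.
  move=> uy; apply: (@cvg_comp _ _ _ (fun i => i.1.1) u); last exact: uy.
  by apply: (@cvg_comp _ _ _ fst fst); exact: cvg_fst.
have Gsnd : i.1.2 @[i --> G] --> w.
  by apply: (@cvg_comp _ _ _ fst snd); [exact: cvg_fst|exact: cvg_snd].
have Gp : i.2 @[i --> G] --> p by exact: cvg_snd.
have xG : x i.1.1 @[i --> G] --> xbar by exact: Gfst.
have JG : 'J F (x i.1.1) @[i --> G] --> 'J F xbar.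
  apply: (@continuous_cvg _ _ _ G _ (fun i => x i.1.1) (fun y => 'J F y)) => //.
  exact: (C2_map_continuous_jacobian oU).
have FG0 : F (x i.1.1) @[i --> G] --> (0 : 'rV[R]_m).
  rewrite -Fxbar.
  apply: (@continuous_cvg _ _ _ G _ (fun i => x i.1.1) F) => //.
  apply: differentiable_continuous.
  exact: (nbhs_singleton (C2_map_near oU Uxbar FU)).
have XE : X i @[i --> G] --> E.
  rewrite /E -[X in _ --> X + _]add0r.
  apply: cvgD; last first.
    by apply: cvg_quad => //; apply: cvg_lagr_hess => //; exact: Gfst.
  apply: cvgD.
    rewrite -oppr0 -(mulr0 (a ^+ 2 * enorm p ^+ 2)) -(mulr0 M) -(@enorm0 R m).
    apply: cvgN; apply: cvgM.
      apply: cvgM; first exact: cvg_cst.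
      rewrite expr2; under eq_fun do rewrite expr2.
      by apply: cvgM; exact: cvg_enorm.
    by apply: cvgM; [exact: cvg_cst|exact: cvg_enorm].
  apply: cvgM; first exact: cvg_cst.
  by apply: cvg_dot => //; exact: cvg_mulmx.
rewrite leNgt; apply/negP => ltE.
have [e lte eE] : exists2 e, (epi_liminf \oo
    (fun k => second_subderiv phi (x k) (v k)) w < e%:E)%E & e < E.
  move: ltE; case: (epi_liminf _ _ w) => [c|//|_].
    by rewrite lte_fin => cE; exists ((c + E) / 2); rewrite ?lte_fin; lra.
  by exists (E - 1); rewrite ?ltNyr//; lra.
have /= [[B V] [[[A W] [/= Aoo Ww] AWB] /= Vp] BV] : G [set i | e < X i].
  exact: (cvgr_gt _ XE).
have LV := pL _ Vp.
have xU : \forall k \near \oo, U (x k) by apply: xx; exact: open_nbhs_nbhs.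
have [K Koo KP] : exists2 K, \oo K & forall k, K k -> [/\ A k /\ U (x k),
    [set` L k] `&` V !=set0,
    [/\ Q (l k), (forall mu, Q mu -> dot (F (x k)) (mu - l k) <= 0),
      v k = l k *m ('J F (x k))^T & twice_epi_differentiable phi (x k) (v k)] &
    [set` L k] `<=` lineality (tangent_cone Q (l k)) /\
    forall q, q \in L k -> enorm q = 1 ->
      (dist 0 (tangent2 Q (l k) q) < M%:E)%E].
  have H' := filterI (filterI (filterI Aoo xU) LV) (filterI lP LP).
  eexists; first exact: H'.
  by move=> k [[[Ak Uk] LVk] [lPk LPk]]; split.
move: lte; rewrite ltNge => /negP; apply.
rewrite /epi_liminf limf_einfE.
apply: le_trans; last first.
  apply: ereal_sup_ubound; exists (K `*` W); last reflexivity.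
  by exists (K, W).
apply: le_ereal_inf_tmp => _ [[k w'] /= [Kk Ww'] <-].
have [[Ak Uk] [q [/= qL Vq]] [Ql lmax vE tE] [Llin LM]] := KP k Kk.
have : e < X (k, w', q) by apply: BV; split => //; exact: AWB.
move=> /ltW eX; apply: (@le_trans _ _ (X (k, w', q))%:E).
  by rewrite lee_fin.
rewrite /X /=.
(* q may vanish when p = 0, and then the constant arc is used *)
have [q0|q0] := eqVneq (enorm q) 0.
  rewrite q0 (enorm_eq0 q0) expr0n /= mulr0 mul0r oppr0 add0r dot0l mulr0 add0r.
  apply: le_trans (second_subderiv_ge w' clQ cQ oU Uk FU phiE Ql lmax vE tE
    (dot0l _) (tangent2_0 Ql) a0).
  by rewrite !dot0l !mulr0 !add0r.
have qgt : 0 < enorm q by rewrite lt_def q0 enorm_ge0.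
pose u := (enorm q)^-1 *: q.
have qE : q = enorm q *: u by rewrite /u scalerA divff// scale1r.
have uL : u \in L k by exact: memvZ.
have u1 : enorm u = 1 by rewrite /u enormZ gtr0_norm ?invr_gt0// mulVf.
have uF : dot u (F (x k)) = 0.
  by rewrite dotC; apply: lineality_perp_normal (Llin _ uL).
have /ereal_inf_lt[_ [r Tr <-]] := LM u uL u1.
rewrite sub0r enormN lte_fin => rM.
have aq : 0 < a * enorm q by rewrite mulr_gt0.
apply: le_trans (second_subderiv_ge w' clQ cQ oU Uk FU phiE Ql lmax vE tE
  uF Tr aq).
rewrite lee_fin lerD2r [in dot q _]qE dotZl exprMn.
have rF : - (M * enorm (F (x k))) <= dot r (F (x k)).
  have := cauchy_schwarz_abs r (F (x k)); rewrite ler_norml => /andP[h _].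
  by apply: le_trans h; rewrite lerN2 ler_wpM2r ?enorm_ge0// ltW.
have -> : 2 * a * (enorm q * dot u (w' *m 'J F (x k))) =
  2 * (a * enorm q) * dot u (w' *m 'J F (x k)) by ring.
rewrite lerD2r -mulrN ler_wpM2l// mulr_ge0// exprn_ge0// ?enorm_ge0//.
exact: ltW.
Qed.

End lower_epi_limit.

(** * Consequences of the strict qualification *)

Section conclusion.
Context {R : realType} {n m : nat}.
Variables (Q : set 'rV[R]_m) (U : set 'rV[R]_n) (F : 'rV[R]_n -> 'rV[R]_m).
Variables (phi : 'rV[R]_n -> \bar R) (b : R).
Variables (xbar : 'rV[R]_n) (lbar : 'rV[R]_m).
Hypotheses (clQ : closed Q) (cQ : convex_set Q) (Qlbar : Q lbar).
Hypotheses (oU : open U) (Uxbar : U xbar) (FU : C2_map_on U F).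
Hypotheses (Fxbar : F xbar = 0).
Hypothesis phiE : forall y, U y -> phi y = (b%:E + support_fun Q (F y))%E.
Hypothesis CQ : [set a - b | a in range (fun h => h *m 'J F xbar)
  & b in normal_cone Q lbar] = setT.

Let S := [set w : 'rV[R]_n | normal_cone Q lbar (w *m 'J F xbar)].

Lemma preimage_cone0 : S 0.
Proof. by rewrite /S /= mul0mx; exact: normal_cone0. Qed.

(** The image of [w] lies in the span of the normal cone, hence is a
    difference y - z of normal vectors. The qualification gives [h] whose
    image is z plus a normal vector, so both [h] and [w + h] belong to [S]. *)
Lemma affine_hull_preimage w :
  (forall p, lineality (tangent_cone Q lbar) p -> dot p (w *m 'J F xbar) = 0) ->
  affine_hull S w.
Proof.
move=> wp.
have [||||y [z [Ny Nz wE]]] :=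
  @biorthogonal_cone R m (normal_cone Q lbar) (w *m 'J F xbar).
- exact: normal_cone0.
- by move=> u v; exact: normal_coneD.
- by move=> a u; exact: normal_coneZ.
- by move=> p Np; rewrite dotC; apply: wp; exact: perp_normal_lineality.
have : [set a - b | a in range (fun h => h *m 'J F xbar)
  & b in normal_cone Q lbar] z by rewrite CQ.
move=> [_ [h _ <-] [u Nu zE]].
have Sh : S h.
  by rewrite /S /= -(subrK u (h *m _)) zE; exact: normal_coneD.
have Swh : S (w + h).
  rewrite /S /= mulmxDl wE -(subrK u (h *m _)) zE addrA subrK.
  exact: normal_coneD.
have sub s : S s -> affine_hull S s.
  move=> Ss; exists 1%N, (fun=> 1), (fun=> s); split => //.
    by rewrite big_ord1.
  by rewrite big_ord1 scale1r.
have [k [B AE]] := affine_hull_linear preimage_cone0.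
rewrite AE /= -(addrK h w); apply: addmx_sub.
  by have := sub _ Swh; rewrite AE.
by rewrite eqmx_opp; have := sub _ Sh; rewrite AE.
Qed.

Lemma cvg_multipliers (x v : nat -> 'rV[R]_n) (l : nat -> 'rV[R]_m) :
  x k @[k --> \oo] --> xbar -> v k @[k --> \oo] --> lbar *m ('J F xbar)^T ->
  (\forall k \near \oo, Q (l k) /\ v k = l k *m ('J F (x k))^T) ->
  l k @[k --> \oo] --> lbar.
Proof.
move=> xx vv lP; have [C C0 CP] := multiplier_bound CQ.
have JJ : 'J F (x k) @[k --> \oo] --> 'J F xbar.
  apply: (@continuous_cvg _ _ _ \oo _ x (fun y => 'J F y)) => //.
  exact: (C2_map_continuous_jacobian oU).
have vd : `|v k - lbar *m ('J F xbar)^T| @[k --> \oo] --> 0.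
  rewrite -(@normr0 R 'rV[R]_n) -(subrr (lbar *m ('J F xbar)^T)).
  by apply: cvg_norm; apply: cvgB => //; exact: cvg_cst.
have Jd : `|'J F (x k) - 'J F xbar| @[k --> \oo] --> 0.
  rewrite -(@normr0 R 'M[R]_(n, m)) -(subrr ('J F xbar)).
  apply: (@cvg_norm _ _ _ \oo); apply: (@cvgB _ _ _ \oo _ _ _ _ _ JJ).
  exact: cvg_cst.
have Jsmall : \forall k \near \oo, C * `|'J F (x k) - 'J F xbar| <= 2^-1.
  apply: (@cvgr_le _ _ \oo _ _ (C * 0)).
    by apply: cvgM => //; exact: cvg_cst.
  by rewrite mulr0.
pose g k := 2 * C * (`|v k - lbar *m ('J F xbar)^T| +
  `|lbar| * `|'J F (x k) - 'J F xbar|).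
have g0 : g k @[k --> \oo] --> 0.
  rewrite -(mulr0 (2 * C)) -[X in _ * X]addr0 -{2}(mulr0 `|lbar|).
  apply: cvgM; first exact: cvg_cst.
  by apply: cvgD => //; apply: cvgM => //; exact: cvg_cst.
have lg : \forall k \near \oo, `|l k - lbar| <= g k.
  apply: filterS2 lP Jsmall => k [Qk vk] Jk.
  by rewrite /g vk; exact: CP.
apply/cvgrPdistC_le => e e0.
have ge : \forall k \near \oo, g k <= e.
  exact: (@cvgr_le _ _ \oo _ _ _ g0 _ e0).
by apply: filterS2 lg ge => k; exact: le_trans.
Qed.

Lemma multipliers_exist : \forall y \near xbar, forall v, subdiff phi y v ->
  exists l, [/\ Q l, v = l *m ('J F y)^T &
    forall mu, Q mu -> dot (F y) (mu - l) <= 0].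
Proof.
have [C C0 CP] := multiplier_bound CQ.
have Jsmall : \forall y \near xbar, C * `|'J F y - 'J F xbar| <= 2^-1.
  apply: (@cvgr_le _ _ (nbhs xbar) _ _ (C * 0)); last by rewrite mulr0.
  apply: (@cvgM _ _ (nbhs xbar)); first exact: cvg_cst.
  rewrite -(@normr0 R 'M[R]_(n, m)) -(subrr ('J F xbar)).
  apply: (@cvg_norm _ _ _ (nbhs xbar)).
  apply: (@cvgB _ _ _ (nbhs xbar)); last exact: cvg_cst.
  exact: (C2_map_continuous_jacobian oU).
have nU : \forall y \near xbar, U y by exact: open_nbhs_nbhs.
have Jsmall2 := near_join Jsmall.
apply: filterS2 nU Jsmall2 => y Uy Jy v.
apply: (limiting_chain_rule clQ cQ (ex_intro _ _ Qlbar)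
  (a := `|lbar| + 2 * C * (1 + `|v - lbar *m ('J F xbar)^T| +
    `|lbar| * (2^-1 / C)))).
- have : \forall z \near y, U z by exact: open_nbhs_nbhs.
  by apply: filterS => z; exact: phiE.
- exact: (C2_map_near oU Uy FU).
- exact: (C2_map_continuous_jacobian oU Uy FU).
apply: filterS Jy => z Jz l Ql lv.
rewrite -(subrK lbar l) addrC (le_trans (ler_normD _ _))// lerD2l.
rewrite (le_trans (CP _ _ Ql Jz))// ler_wpM2l ?mulr_ge0 ?(ltW C0)//.
rewrite lerD//.
  rewrite -(subrKA v) (le_trans (ler_normD _ _))// lerD2r//.
by rewrite ler_wpM2l// ler_pdivlMr// mulrC.
Qed.

(** On the affine hull of [S] the direction p = 0 gives the quadratic term.
    Outside it some [p] in the lineality space has <p, DF(xbar) w> > 0, and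
    letting the parameter [a] grow makes the bound infinite. *)
Lemma epi_liminf_lower_bound (x v : nat -> 'rV[R]_n) (l : nat -> 'rV[R]_m)
    (L : nat -> {vspace 'rV[R]_m}) (M : R) w :
  x k @[k --> \oo] --> xbar -> v k @[k --> \oo] --> lbar *m ('J F xbar)^T ->
  (\forall k \near \oo, [/\ Q (l k),
    (forall mu, Q mu -> dot (F (x k)) (mu - l k) <= 0),
    v k = l k *m ('J F (x k))^T & twice_epi_differentiable phi (x k) (v k)]) ->
  (\forall k \near \oo, [set` L k] `<=` lineality (tangent_cone Q (l k)) /\
    forall q, q \in L k -> enorm q = 1 ->
      (dist 0 (tangent2 Q (l k) q) < M%:E)%E) ->
  lineality (tangent_cone Q lbar) `<=` pk_liminf \oo (fun k => [set` L k]) ->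
  ((quad (lagr_hess F xbar lbar) w)%:E + indicator (affine_hull S) w <=
    epi_liminf \oo (fun k => second_subderiv phi (x k) (v k)) w)%E.
Proof.
move=> xx vv lP LP linL.
have ll : l k @[k --> \oo] --> lbar.
  by apply: (cvg_multipliers xx vv); apply: filterS lP => k [].
have bound p a : lineality (tangent_cone Q lbar) p -> 0 < a ->
    ((2 * a * dot p (w *m 'J F xbar) + quad (lagr_hess F xbar lbar) w)%:E <=
    epi_liminf \oo (fun k => second_subderiv phi (x k) (v k)) w)%E.
  move=> pl a0.
  exact: (epi_liminf_ge clQ cQ oU Uxbar FU Fxbar phiE w xx ll lP LP
    (linL _ pl)).
rewrite /indicator; case: asboolP => [Sw|nSw].
  have lin0 : lineality (tangent_cone Q lbar) 0.
    by apply: perp_normal_lineality => // y _; rewrite dot0r.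
  by have := bound 0 1 lin0 ltr01; rewrite dot0l mulr0 add0r adde0.
have [p plin pw] : exists2 p, lineality (tangent_cone Q lbar) p &
    0 < dot p (w *m 'J F xbar).
  apply: contrapT => np; apply: nSw; apply: affine_hull_preimage => p plin.
  have le0 q : lineality (tangent_cone Q lbar) q -> dot q (w *m 'J F xbar) <= 0.
    by move=> qlin; rewrite leNgt; apply/negP => q0; apply: np; exists q.
  apply/le_anti; rewrite le0//= -oppr_le0 -dotNl le0//.
  by case: plin => T1 T2; split; rewrite ?opprK.
set d := dot p _ in pw; set c := quad _ _.
have large (e : R) : (e%:E <=
    epi_liminf \oo (fun k => second_subderiv phi (x k) (v k)) w)%E.
  pose a := (`|e - c| + 1) / (2 * d).
  have a0 : 0 < a by rewrite divr_gt0 ?mulr_gt0// ltr_wpDl.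
  apply: le_trans (bound p a plin a0); rewrite lee_fin -/d -/c.
  have -> : 2 * a * d = `|e - c| + 1 by rewrite /a; field; rewrite gt_eqF.
  by have := ler_norm (e - c); lra.
rewrite addey//.
move: large; case: (epi_liminf _ _ _) => [s|//|] large.
  by have := large ((s : R) + 1); rewrite lee_fin gerDl ler10.
by have := large 0.
Qed.

End conclusion.

(** * Lower bounds along sequences of twice epi-differentiable points *)

Unset Implicit Arguments.

Theorem theorem3p8 (R : realType) (n m : nat)
    (f : 'rV[R]_n -> R) (phi : 'rV[R]_n -> \bar R)
    (xbar vbar : 'rV[R]_n) (tau rho : R)
    (Q : set 'rV[R]_m) (F : 'rV[R]_n -> 'rV[R]_m) (lbar : 'rV[R]_m)
    (f_C2 : C2_on setT f)
    (phi_proper : proper_fun phi)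
    (phi_lsc : lower_semicontinuous phi)
    (phi_prox_bounded : prox_bounded phi)
    (xbar_stationary : subdiff (fun x => ((f x)%:E + phi x)%E) xbar 0)
    (vbar_grad : vbar = - grad f xbar)
    (tau_gt0 : 0 < tau)
    (phi_prox_regular : globally_prox_regular phi xbar vbar rho)
    (tau_rho : tau * rho < 1)
    (phi_decomposable : C2_strictly_decomposable phi xbar Q F lbar)
    (vbar_lbar : vbar = lbar *m ('J F xbar)^T) :
  let S := [set w : 'rV[R]_n | normal_cone Q lbar (w *m 'J F xbar)] in
  (* (a) *)
  (forall (x v : nat -> 'rV[R]_n) (M : R) (l : nat -> 'rV[R]_m)
      (L : nat -> {vspace 'rV[R]_m}),
    (forall k, subdiff phi (x k) (v k)) ->
    x k @[k --> \oo] --> xbar ->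
    v k @[k --> \oo] --> vbar ->
    (forall k, twice_epi_differentiable phi (x k) (v k)) ->
    0 < M ->
    (forall k, v k = l k *m ('J F (x k))^T) ->
    (forall k, subdiff (support_fun Q) (F (x k)) (l k)) ->
    (forall k, [set` L k] `<=` lineality (tangent_cone Q (l k))) ->
    pk_cvg \oo (fun k => [set` L k]) (lineality (tangent_cone Q lbar)) ->
    (forall k p, p \in L k -> enorm p = 1 ->
      (dist 0 (tangent2 Q (l k) p) < M%:E)%E) ->
    forall w,
      ((quad (lagr_hess F xbar lbar) w)%:E + indicator (affine_hull S) w
       <= epi_liminf \oo
            (fun k => second_subderiv phi (x k) (l k *m ('J F (x k))^T)) w)%E)
  /\
  (* (b) *)
  (tangent2_path_property Q lbar ->
    let P := orth_proj (affine_hull S) in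
    forall x v : nat -> 'rV[R]_n,
    (forall k, subdiff phi (x k) (v k)) ->
    x k @[k --> \oo] --> xbar ->
    v k @[k --> \oo] --> vbar ->
    (forall k, twice_epi_differentiable phi (x k) (v k)) ->
    (forall k, generalized_quadratic (second_subderiv phi (x k) (v k))) ->
    forall w,
      ((quad (P *m lagr_hess F xbar lbar *m P) w)%:E
         + indicator (affine_hull S) w
       <= epi_liminf \oo (fun k => second_subderiv phi (x k) (v k)) w)%E).
Proof.
have [[phifin [clQ cQ Qproper] Fxbar [U [oU Uxbar FU phiU]] _] Qlbar CQ] :=
  phi_decomposable.
move=> S.
have [b bE] : exists b, phi xbar = b%:E.
  by exists (fine (phi xbar)); rewrite fineK.
have phiE y : U y -> phi y = (b%:E + support_fun Q (F y))%E.
  by rewrite -bE; exact: phiU.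
have Q0 : Q !=set0 by exists lbar.
rewrite vbar_lbar.
split.
  move=> x v M l L vphi xx vv tE M0 vE lsub Llin Lcvg LM w.
  have -> : (fun k => second_subderiv phi (x k) (l k *m ('J F (x k))^T)) =
      (fun k => second_subderiv phi (x k) (v k)).
    by apply/funext => k; rewrite vE.
  apply: (epi_liminf_lower_bound clQ cQ Qlbar oU Uxbar FU Fxbar phiE CQ
    (l := l) (L := L) (M := M)) => //.
  - apply: nearW => k.
    have [Ql lmax] := support_subdiff clQ cQ Q0 (lsub k).
    exact: And4 Ql lmax (vE k) (tE k).
  - by apply: nearW => k; split; [exact: Llin|exact: LM].
  - by have [<- _] := Lcvg.
move=> [_ [M [V [L [M0 Vl Llin [Linf _] LM]]]]] P x v vphi xx vv tE _ w.
have lex : \forall k \near \oo, exists l, [/\ Q l, v k = l *m ('J F (x k))^T &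
    forall mu, Q mu -> dot (F (x k)) (mu - l) <= 0].
  have H := xx _ (multipliers_exist clQ cQ Qlbar oU Uxbar FU phiE CQ).
  by apply: (@filterS _ \oo _ _ _ _ H) => k Hk; exact: Hk (vphi k).
have /choice[l lP] k : exists l, (exists l, [/\ Q l, v k = l *m ('J F (x k))^T &
    forall mu, Q mu -> dot (F (x k)) (mu - l) <= 0]) ->
  [/\ Q l, v k = l *m ('J F (x k))^T &
    forall mu, Q mu -> dot (F (x k)) (mu - l) <= 0].
  have [[l H]|nl] := pselect (exists l, [/\ Q l, v k = l *m ('J F (x k))^T &
    forall mu, Q mu -> dot (F (x k)) (mu - l) <= 0]); last by exists 0.
  by exists l.
have {lex}lP : \forall k \near \oo, [/\ Q (l k), v k = l k *m ('J F (x k))^T &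
    forall mu, Q mu -> dot (F (x k)) (mu - l k) <= 0].
  by apply: filterS lex => k; exact: lP.
have ll : l k @[k --> \oo] --> lbar.
  by apply: (cvg_multipliers oU Uxbar FU CQ xx vv); apply: filterS lP => k [].
have lV : \forall k \near \oo, V (l k) by exact: ll.
have bound := epi_liminf_lower_bound clQ cQ Qlbar oU Uxbar FU Fxbar phiE CQ
  (l := l) (L := L \o l) (M := M) w xx vv.
have -> : ((quad (P *m lagr_hess F xbar lbar *m P) w)%:E +
    indicator (affine_hull S) w = (quad (lagr_hess F xbar lbar) w)%:E +
    indicator (affine_hull S) w)%E.
  rewrite /indicator; case: asboolP => [Sw|_]; last by rewrite !addey.
  congr (_%:E + _)%E.
  have [wP PT] := orth_proj_id (preimage_cone0 F xbar Qlbar) Sw.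
  have PwT : P *m w^T = w^T by rewrite -[in RHS]wP trmx_mul PT.
  by rewrite /quad !mulmxA wP -mulmxA PwT.
apply: bound.
- by apply: filterS lP => k [Ql vk lmax]; exact: And4 Ql lmax vk (tE k).
- apply: filterS2 lP lV => k [Ql _ _] Vlk; split; first exact: Llin.
  exact: LM.
rewrite -Linf => p pinf W Wp.
have := pinf W Wp; rewrite /= => H.
have := ll _ H; apply: filterS2 lP => k [Ql _ _]; exact.
Qed.
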